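(* Let $Y(u)\in\mathbb{R}^m_{\ge 0}$ denote a solution of the system $$\frac{dY_i}{du}=-Y_iF_i(Y),\qquad 1\le i\le m.\tag{Y}$$ (i) There is a constant $c_0>0$ such that if $\sum_{i=1}^m Y_i(0)\le c_0$, then the solution $Y(u)$ satisfies $\lim_{u\to\infty}Y(u)=0$. If $Y(u)$ further satisfies $Y(u)\in\mathbb{R}^m_{>0}$, then the corresponding $g_{a,\vec b}(\tau)$ is an ancient solution of the Ricci flow on the circle bundle $P_Q$. (ii) There is a $C^0$-family of solutions $Y(u)$ with $(m-2)$ parameters which satisfy $\lim_{u\to\infty}Y(u)=\xi$. Each corresponding $g_{a,\vec b}(\tau)$ is an ancient solution of the Ricci flow. (iii) For each nontrivial subset $\theta\subset\{1,\dots,m\}$ (nonempty and proper) there is a $C^0$-family of solutions $Y(u)$ (defined for all $u\geq 0$) with $(|\theta|-2)$ parameters which satisfy $\lim_{u\to\infty}Y(u)=v_\theta$ and $Y_k(u)=0$ for $k\notin\theta$. But they do not produce any ancient solution of the Ricci flow on $P_Q$ (that is, they do not correspond to metrics $g_{a,\vec b}(\tau)$ on $P_Q$).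
   Context: For $1\le i\le m$, $(M_i,g_i)$ is a compact Kähler–Einstein manifold of complex dimension $n_i$, $\mathrm{Rc}(g_i)=p_ig_i$ with $p_i$ a positive integer, with Kähler form $\omega_i$, scaled so that $\frac1{2\pi}[\omega_i]$ is integral and represents a torsion-free indivisible class in $H^2(M_i,\mathbb{Z})$. Let $q_1,\dots,q_m$ be nonzero integers and $P_Q\to M_1\times\cdots\times M_m$ the principal circle bundle with Euler class $\frac1{2\pi}\sum_iq_i[\omega_i]$, with principal connection $\sigma$ of curvature form $d\sigma=\sum_iq_i\omega_i$. Consider metrics $g_{a,\vec b}(\tau)=a(\tau)\,\sigma\otimes\sigma+\sum_ib_i(\tau)g_i$, $a,b_i>0$ ($g_i$ pulled back). With $\tau=-t$ the backwards Ricci flow for $g_{a,\vec b}(\tau)$ is $$\frac{da}{d\tau}=\sum_{i}n_iq_i^2\frac{a^2}{b_i^2},\qquad \frac{db_i}{d\tau}=2p_i-q_i^2\frac{a}{b_i}.$$ An ancient solution is one existing for all $t\in(-\infty,T)$ for some finite $T$ (i.e. for all large $\tau$). Put $Y_i=a/b_i$, $u=\int_0^\tau\frac{d\zeta}{a(\zeta)}$, $E(Y)=\sum_in_iq_i^2Y_i^2$, $F_i(Y)=2p_iY_i-q_i^2Y_i^2-E(Y)$. Then the flow becomes $\frac{d\ln a}{du}=E(Y)$ together with system (Y). Conversely, a solution $Y(u)\in\mathbb{R}^m_{>0}$ of (Y) and a choice of $a(0)>0$ determine the corresponding $g_{a,\vec b}(\tau)$ by $a(u)=a(0)\exp\int_0^uE(Y(\zeta))d\zeta$,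 $\tau(u)=\int_0^ua(\zeta)d\zeta$, $b_i=a/Y_i$. $\xi\in\mathbb{R}^m_{>0}$ is the unique point with $\xi_i>0$ and $F_i(\xi)=0$ for all $i$. For nonempty proper $\theta\subset\{1,\dots,m\}$, $v_\theta$ is the unique point with $F_i(v_\theta)=0$ and $(v_\theta)_i>0$ for $i\in\theta$, and $(v_\theta)_j=0$ for $j\notin\theta$. The numbers of parameters in (ii) and (iii) count solutions as flow lines, i.e. modulo translation in $u$; the assertions on families with a given number of parameters are meant when that number is nonnegative. *)

(* Defs.v *)
From HB Require Import structures.
From mathcomp Require Import all_boot all_order all_algebra.
From mathcomp Require Import all_classical all_reals all_analysis.

Set Implicit Arguments.
Unset Strict Implicit.
Unset Printing Implicit Defensive.

Import Order.TTheory GRing.Theory Num.Theory.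
Import numFieldNormedType.Exports.

Local Open Scope classical_set_scope.
Local Open Scope ring_scope.

(* The Kaehler-Einstein factors M_i (complex dimension n i, Einstein constant
   p i) and the Euler class of the circle bundle (coefficients q i) enter the
   Ricci flow of the metrics a sigma (x) sigma + sum_i b_i g_i only through the
   numbers n i, p i, q i.  A point of R^m is a row vector Y, with coordinates
   Y 0 i. *)

Definition E (R : realType) (m : nat) (n : 'I_m -> nat) (q : 'I_m -> int)
    (Y : 'rV[R]_m) : R :=
  \sum_(i < m) (n i)%:R * (q i)%:~R ^+ 2 * Y 0 i ^+ 2.

Definition F (R : realType) (m : nat) (n p : 'I_m -> nat) (q : 'I_m -> int)
    (i : 'I_m) (Y : 'rV[R]_m) : R :=
  2 * (p i)%:R * Y 0 i - (q i)%:~R ^+ 2 * Y 0 i ^+ 2 - E n q Y.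

(* Solutions on [0, +oo[ with values in the closed orthant.  Y is a total
   function whose values at u < 0 are irrelevant, hence the one-sided
   continuity at 0 and the derivative at interior points only. *)
Definition solution_Y (R : realType) (m : nat) (n p : 'I_m -> nat)
    (q : 'I_m -> int) (Y : R -> 'rV[R]_m) : Prop :=
  [/\ forall u : R, 0 <= u -> forall i, 0 <= Y u 0 i,
      {within `[0, +oo[, continuous Y} &
      forall u : R, 0 < u -> forall i,
        is_derive u 1 (fun v => Y v 0 i) (- Y u 0 i * F n p q i (Y u))].

Definition positive_Y (R : realType) (m : nat) (Y : R -> 'rV[R]_m) : Prop :=
  forall u : R, 0 <= u -> forall i, 0 < Y u 0 i.

Definition is_xi (R : realType) (m : nat) (n p : 'I_m -> nat)
    (q : 'I_m -> int) (xi : 'rV[R]_m) : Prop :=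
  forall i, 0 < xi 0 i /\ F n p q i xi = 0.

Definition is_v (R : realType) (m : nat) (n p : 'I_m -> nat)
    (q : 'I_m -> int) (theta : {set 'I_m}) (v : 'rV[R]_m) : Prop :=
  (forall i, i \in theta -> 0 < v 0 i /\ F n p q i v = 0) /\
  (forall j, j \notin theta -> v 0 j = 0).

(* The condition for (a, b) to define a Riemannian metric g_{a,b}. *)
Definition is_metric (R : realType) (m : nat) (a : R) (b : 'rV[R]_m) : Prop :=
  0 < a /\ forall i, 0 < b 0 i.

(* Backwards Ricci flow for g_{a,b}(tau), tau = - t, on ]tau0, +oo[; such a
   solution is ancient, living on t in ]-oo, T[ with T = - tau0. *)
Definition ancient_solution (R : realType) (m : nat) (n p : 'I_m -> nat)
    (q : 'I_m -> int) (a : R -> R) (b : R -> 'rV[R]_m) : Prop :=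
  exists tau0 : R, forall tau : R, tau0 < tau ->
    [/\ is_metric (a tau) (b tau),
        is_derive tau 1 a
          (\sum_(i < m) (n i)%:R * (q i)%:~R ^+ 2 *
                        (a tau ^+ 2 / b tau 0 i ^+ 2)) &
        forall i, is_derive tau 1 (fun s => b s 0 i)
          (2 * (p i)%:R - (q i)%:~R ^+ 2 * (a tau / b tau 0 i))].

Definition a_of (R : realType) (m : nat) (n : 'I_m -> nat) (q : 'I_m -> int)
    (Y : R -> 'rV[R]_m) (a0 u : R) : R :=
  a0 * expR (\int[lebesgue_measure]_(z in `[0, u]) E n q (Y z)).

Definition tau_of (R : realType) (m : nat) (n : 'I_m -> nat) (q : 'I_m -> int)
    (Y : R -> 'rV[R]_m) (a0 u : R) : R :=
  \int[lebesgue_measure]_(z in `[0, u]) a_of n q Y a0 z.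

(* The metrics g_{a,b}(tau) correspond to the solution Y(u) and to the initial
   value a(0) = a0.  The relation is written Y_i = a / b_i, with b_i > 0, and
   not b_i = a / Y_i, because Y_i may vanish. *)
Definition corresponds (R : realType) (m : nat) (n : 'I_m -> nat)
    (q : 'I_m -> int) (Y : R -> 'rV[R]_m) (a0 : R)
    (a : R -> R) (b : R -> 'rV[R]_m) : Prop :=
  forall u : R, 0 <= u -> let tau := tau_of n q Y a0 u in
    [/\ is_metric (a tau) (b tau),
        a tau = a_of n q Y a0 u &
        forall i, Y u 0 i = a tau / b tau 0 i].

(* Every a(0) > 0 determines metrics corresponding to Y, and these form an
   ancient solution.  The second half quantifies over all total functions a, b
   with the prescribed values on tau_of @` [0, +oo[, so it can only hold if
   tau_of is unbounded. *)
Definition yields_ancient_solution (R : realType) (m : nat)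
    (n p : 'I_m -> nat) (q : 'I_m -> int) (Y : R -> 'rV[R]_m) : Prop :=
  forall a0 : R, 0 < a0 ->
    (exists a b, corresponds n q Y a0 a b) /\
    (forall a b, corresponds n q Y a0 a b -> ancient_solution n p q a b).

(* Equality up to translation in u, for curves defined on [0, +oo[. *)
Definition same_flow_line (R : realType) (m : nat) (Y Z : R -> 'rV[R]_m) :
    Prop :=
  exists2 c : R, 0 <= c &
    (forall u : R, 0 <= u -> Z u = Y (u + c)) \/
    (forall u : R, 0 <= u -> Y u = Z (u + c)).

(* A C^0-family with d parameters of flow lines of (Y): Phi depends jointly
   continuously on the parameter s, in a nonempty open set U of R^d, and on u;
   distinct parameters give distinct flow lines.  Stationary points are not
   counted as flow lines, so that the solutions sweep out d + 1 dimensions. *)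
Definition C0_family (R : realType) (m : nat) (n p : 'I_m -> nat)
    (q : 'I_m -> int) (d : nat) (U : set 'rV[R]_d)
    (Phi : 'rV[R]_d -> R -> 'rV[R]_m) : Prop :=
  [/\ open U, U !=set0,
      {within U `*` `[0, +oo[, continuous (fun z => Phi z.1 z.2)},
      forall s, U s -> solution_Y n p q (Phi s) /\
        ~ (forall u : R, 0 <= u -> Phi s u = Phi s 0) &
      forall s s', U s -> U s' -> same_flow_line (Phi s) (Phi s') -> s = s'].

(* Main.v *)
(* Weighted by [c_i = n_i q_i^2], the linearization of (Y) at an equilibrium
   [v] is a self-adjoint operator "diagonal plus rank one" on R^theta, whose
   eigenvector [e] for the only positive eigenvalue is found from the secular
   equation; it is negative definite on the orthogonal complement of [e].  After
   the nonlinear part is cut off, the difference [w] of any two solutions obeys a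
   cone condition: (e-component)^2 - |orthogonal component|^2 is nondecreasing,
   and grows without bound once positive.  For each orthogonal component [s], the
   values of the e-component for which the solution leaves [v] upwards and
   downwards form two disjoint nonempty open sets, so by connectedness some value
   lies in neither, and the corresponding solution tends to [v] exponentially.
   By the cone condition this value is a Lipschitz function of [s].  Along these
   solutions |orthogonal component| decreases strictly, so each flow line meets a
   sphere of dimension |theta| - 2 exactly once, and a chart of the sphere gives
   the family.

   Near 0, [S = sum_i Y_i] satisfies [S' <= (C S - 2) sum_i Y_i^2].  Finally
   [E >= 0] gives [a >= a(0)], hence [tau >= a(0) u] is unbounded and every positive
   solution yields an ancient one. *)

Require Import Defs.
From HB Require Import structures.
From mathcomp Require Import all_boot all_order all_algebra.
From mathcomp Require Import all_classical all_reals all_analysis.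
From mathcomp Require Import ring lra.

Set Implicit Arguments.
Unset Strict Implicit.
Unset Printing Implicit Defensive.

Import Order.TTheory GRing.Theory Num.Theory.
Import numFieldNormedType.Exports.

Local Open Scope classical_set_scope.
Local Open Scope ring_scope.

(** * Functions on the half-line [0, +oo[ *)

Definition cts_pos (R : realType) (V : topologicalType) (f : R -> V) : Prop :=
  {within `[0, +oo[, continuous f}.

Lemma cts_pos_itv (R : realType) (V : topologicalType) (f : R -> V) (a b : R) :
  cts_pos f -> 0 <= a -> {within `[a, b], continuous f}.
Proof.
move=> cf a0; apply: continuous_subspaceW cf => x /=.
by rewrite !in_itv/= andbT => /andP[/(le_trans a0)].
Qed.

Lemma cts_pos_at (R : realType) (V : topologicalType) (f : R -> V) (u : R) :
  cts_pos f -> 0 < u -> {for u, continuous f}.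
Proof.
move=> cf u0.
have cf' : {within `]0, +oo[, continuous f}.
  apply: continuous_subspaceW cf => x /=.
  by rewrite !in_itv/= !andbT => /ltW.
have := continuous_open_subspace f (interval_open (a:=BRight 0) (b:=+oo%O) isT isT).
move=> H; move: cf'; rewrite H; apply.
by rewrite inE/= in_itv/= u0.
Qed.

Lemma ctsP (R : realType) (V : normedModType R) (f : R -> V) :
  cts_pos f <-> forall u : R, 0 <= u -> forall e : R, 0 < e ->
    exists2 d, 0 < d & forall v, 0 <= v -> `|u - v| < d -> `|f u - f v| < e.
Proof.
split.
  move=> cf u u0 e e0.
  move/subspace_continuousP : cf => /(_ u).
  rewrite /= in_itv/= u0/= => /(_ isT)/cvgrPdist_lt/(_ _ e0).
  rewrite near_withinE => -[d/= d0 H]; exists d => // v v0 uv.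
  by apply: H => //=; rewrite in_itv/= v0.
move=> H; apply/subspace_continuousP => u /=; rewrite in_itv/= andbT => u0.
apply/cvgrPdist_lt => e e0; rewrite near_withinE.
have [d d0 Hd] := H u u0 e e0.
exists d => //= v /= uv; rewrite in_itv/= andbT => v0; exact: Hd.
Qed.

Lemma sum_ord_le (R : realType) (m : nat) (f : 'I_m -> R) (D : R) :
  (forall i, f i <= D) -> \sum_i f i <= m%:R * D.
Proof.
move=> H; apply: le_trans (ler_sum _ (fun i _ => H i)) _.
by rewrite sumr_const card_ord mulr_natl.
Qed.

Lemma finite_lower_bound (R : realType) (I : finType) (A : pred I) (f : I -> R) :
  (forall i, A i -> 0 < f i) -> exists2 d : R, 0 < d & forall i, A i -> d <= f i.
Proof.
move=> f0; have S0 (B : pred I) : 0 <= \sum_(i | A i && B i) (f i)^-1.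
  by apply: sumr_ge0 => i /andP[Ai _]; rewrite invr_ge0 ltW// f0.
have := S0 predT; under eq_bigl do rewrite andbT.
pose T := 1 + \sum_(i | A i) (f i)^-1 => S0'.
have T0 : 0 < T by rewrite ltr_pwDl.
exists T^-1 => [|i Ai]; first by rewrite invr_gt0.
rewrite -[leRHS]invrK lef_pV2 ?posrE ?invr_gt0 ?f0//.
by rewrite /T (bigD1 i)//= addrCA lerDl addr_ge0.
Qed.

Lemma rV_norm_le (R : realType) (m : nat) (x : 'rV[R]_m) (D : R) :
  0 <= D -> (`|x| <= D) <-> (forall i, `|x 0 i| <= D).
Proof.
move=> D0; rewrite [X in X <= _](mx_normrE x); split=> [xD i|xD].
  by apply: le_trans xD; apply: (le_bigmax _ (fun ij => `|x ij.1 ij.2|) (ord0, i)).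
by apply: bigmax_le => // -[j i] _ /=; rewrite ord1.
Qed.

Lemma rV_norm_lt (R : realType) (m : nat) (x : 'rV[R]_m) (D : R) :
  0 < D -> (`|x| < D) <-> (forall i, `|x 0 i| < D).
Proof.
move=> D0; rewrite [X in X < _](mx_normrE x); split=> [xD i|xD].
  apply: le_lt_trans xD.
  by apply: (le_bigmax _ (fun ij => `|x ij.1 ij.2|) (ord0, i)).
by apply: bigmax_lt => // -[j i] _ /=; rewrite ord1.
Qed.

Lemma cvg_rV (R : realType) (m : nat) (T : Type) (F : set_system T)
    (FF : Filter F) (f : T -> 'rV[R]_m) (l : 'rV[R]_m) :
  (forall i, f x 0 i @[x --> F] --> l 0 i) -> f x @[x --> F] --> l.
Proof.
move=> fl; apply/cvgrPdist_lt => e e0.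
have : \forall x \near F, forall i, true -> `|l 0 i - f x 0 i| < e.
  by apply: filter_forall => i; have /cvgrPdist_lt/(_ _ e0) := fl i;
     apply: filterS.
apply: filterS => x H; apply/rV_norm_lt => // i; rewrite !mxE; exact: H.
Qed.

Lemma cts_pos_comp (R : realType) (V W : topologicalType) (h : V -> W) (f : R -> V) :
  continuous h -> cts_pos f -> cts_pos (h \o f).
Proof.
by move=> ch cf x; apply: cvg_comp; [exact: cf|exact: ch].
Qed.

Lemma cts_row (R : realType) (m : nat) (Y : R -> 'rV[R]_m) :
  (forall i, cts_pos (fun u => Y u 0 i)) <-> cts_pos Y.
Proof.
split=> cY; last first.
  by move=> i; exact: (cts_pos_comp (@coord_continuous _ _ _ 0 i)).
move=> x; apply: cvg_rV => i; exact: cY.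
Qed.

Lemma deriv_cts_pos (R : realType) (f df : R -> R) :
  (forall u : R, 0 <= u -> is_derive u 1 f (df u)) -> cts_pos f.
Proof.
move=> fd; apply: continuous_in_subspaceT => u; rewrite inE/= in_itv/= andbT => u0.
exact/differentiable_continuous/derivable1_diffP/(@ex_derive _ _ _ _ _ _ _ (fd u u0)).
Qed.

Lemma ndecr_pos (R : realType) (f df : R -> R) (a b : R) :
  cts_pos f -> (forall u : R, 0 < u -> is_derive u 1 f (df u)) ->
  0 <= a -> a <= b -> (forall u : R, a < u -> u < b -> 0 <= df u) -> f a <= f b.
Proof.
move=> cf fd a0 ab df0; move: (ab); rewrite le_eqVlt => /predU1P[->//|ab'].
have fd' x : x \in `]a, b[ -> is_derive x 1 f (df x).
  by rewrite in_itv/= => /andP[ax _]; apply/fd/(le_lt_trans a0).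
have [c] := MVT ab' fd' (@cts_pos_itv _ _ _ _ b cf a0).
rewrite in_itv/= => /andP[ac cb] E.
by rewrite -subr_ge0 E mulr_ge0 ?df0 ?subr_ge0.
Qed.

Lemma cts_pos_cst (R : realType) (V : topologicalType) (k : V) :
  cts_pos (fun _ : R => k).
Proof. exact/continuous_subspaceT/cst_continuous. Qed.

Lemma cts_posD (R : realType) (f g : R -> R) :
  cts_pos f -> cts_pos g -> cts_pos (fun u => f u + g u).
Proof. by move=> cf cg x; apply: cvgD; [exact: cf|exact: cg]. Qed.

Lemma cts_posB (R : realType) (f g : R -> R) :
  cts_pos f -> cts_pos g -> cts_pos (fun u => f u - g u).
Proof. by move=> cf cg x; apply: cvgB; [exact: cf|exact: cg]. Qed.

Lemma cts_posM (R : realType) (f g : R -> R) :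
  cts_pos f -> cts_pos g -> cts_pos (fun u => f u * g u).
Proof. by move=> cf cg x; apply: cvgM; [exact: cf|exact: cg]. Qed.

Lemma cts_posV (R : realType) (f : R -> R) :
  cts_pos f -> (forall u : R, 0 <= u -> f u != 0) -> cts_pos (fun u => (f u)^-1).
Proof.
move=> /subspace_continuousP cf f0; apply/subspace_continuousP => u u0.
by apply: cvgV; [apply: f0; move: u0; rewrite /= in_itv/= andbT|exact: cf].
Qed.

Lemma cts_posX (R : realType) (f : R -> R) n :
  cts_pos f -> cts_pos (fun u => f u ^+ n).
Proof.
move=> cf; elim: n => [|n IH]; first exact: cts_pos_cst.
by under eq_fun do rewrite exprS; exact: cts_posM.
Qed.

Lemma cts_pos_sum (R : realType) (I : finType) (P : pred I) (f : I -> R -> R) :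
  (forall i, P i -> cts_pos (f i)) -> cts_pos (fun u => \sum_(i | P i) f i u).
Proof.
move=> cf; have -> : (fun u => \sum_(i | P i) f i u) = \sum_(i | P i) f i.
  by apply/funext => u; rewrite fct_sumE.
apply: (big_ind (@cts_pos R R)) => //; first exact: cts_pos_cst.
by move=> g h cg ch; exact: cts_posD.
Qed.

Definition primitive (R : realType) (f : R -> R) (u : R) : R :=
  \int[lebesgue_measure]_(z in `[0, u]) f z.

Lemma cts_integrable (R : realType) (f : R -> R) (b : R) : cts_pos f ->
  (@lebesgue_measure R).-integrable `[0, b] (EFin \o f).
Proof.
move=> cf; apply: continuous_compact_integrable; first exact: segment_compact.
exact: cts_pos_itv.
Qed.

Lemma primitive0 (R : realType) (f : R -> R) : primitive f 0 = 0.
Proof. by rewrite /primitive set_itv1 Rintegral_set1. Qed.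

Lemma primitive_derive (R : realType) (f : R -> R) (u : R) :
  cts_pos f -> 0 < u -> is_derive u 1 (primitive f) (f u).
Proof.
move=> cf u0.
have uu : u < u + 1 by rewrite ltrDl.
have [D <-] := continuous_FTC1_closed uu (cts_integrable (u + 1) cf) u0 (cts_pos_at cf u0).
by rewrite derive1E; exact: derivableP.
Qed.

Lemma primitive_cts (R : realType) (f : R -> R) : cts_pos f -> cts_pos (primitive f).
Proof.
move=> cf; apply/ctsP => u u0 e e0.
have u1 : 0 <= u + 1 by rewrite addr_ge0.
have := parameterized_integral_continuous u1 (cts_integrable (u + 1) cf).
move=> /subspace_continuousP/(_ u)/=.
rewrite in_itv/= u0/= lerDl ler01 => /(_ isT)/cvgrPdist_lt/(_ _ e0).
rewrite near_withinE => -[d/= d0 H]; exists (Num.min d 1).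
  by rewrite lt_min d0/=.
move=> v v0; rewrite lt_min => /andP[uvd uv1].
apply: H => //=; rewrite in_itv/= v0/=.
by move: uv1; rewrite distrC ltr_norml => /andP[_]; lra.
Qed.

Lemma is_derive_eq_pos (R : realType) (f g : R -> R) (u d : R) :
  (forall v : R, 0 <= v -> f v = g v) -> 0 < u ->
  is_derive u 1 f d -> is_derive u 1 g d.
Proof.
move=> fg u0; apply: near_eq_is_derive; near=> v; apply: fg.
by apply: ltW; near: v; exact: lt_nbhsr.
Unshelve. all: by end_near. Qed.

(** * Global flows of Lipschitz vector fields *)

Lemma is_derive_expRM (R : realType) (k x : R) :
  is_derive x 1 (fun u => expR (k * u)) (k * expR (k * x)).
Proof.
have kD : is_derive x 1 (fun u : R => k * u) k.
  by rewrite -[X in is_derive _ _ _ X]mulr1; exact: is_deriveZ.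
by rewrite mulrC; exact: (is_derive1_comp (f := expR) (is_derive_expR _) kD).
Qed.

Lemma expRM_cts_pos (R : realType) (k : R) : cts_pos (fun u => expR (k * u)).
Proof. by apply: deriv_cts_pos => u _; exact: is_derive_expRM. Qed.

Lemma le_diff_pos (R : realType) (f df g dg : R -> R) (a b : R) :
  cts_pos f -> (forall u : R, 0 < u -> is_derive u 1 f (df u)) ->
  cts_pos g -> (forall u : R, 0 < u -> is_derive u 1 g (dg u)) ->
  0 <= a -> a <= b -> (forall u : R, a < u -> u < b -> `|df u| <= dg u) ->
  `|f b - f a| <= g b - g a.
Proof.
move=> cf fd cg gd a0 ab H.
have P : forall u : R, 0 < u -> is_derive u 1 (fun v => g v - f v) (dg u - df u).
  by move=> u u0; apply: is_deriveB; [exact: gd|exact: fd].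
have Q : forall u : R, 0 < u -> is_derive u 1 (fun v => g v + f v) (dg u + df u).
  by move=> u u0; apply: is_deriveD; [exact: gd|exact: fd].
have := ndecr_pos (cts_posB cg cf) P a0 ab.
have := ndecr_pos (cts_posD cg cf) Q a0 ab.
move=> h1 h2; rewrite ler_norml.
have {}h1 : g a + f a <= g b + f b.
  by apply: h1 => u au ub; have := H u au ub; rewrite ler_norml => /andP[]; lra.
have {}h2 : g a - f a <= g b - f b.
  by apply: h2 => u au ub; have := H u au ub; rewrite ler_norml => /andP[]; lra.
by apply/andP; split; lra.
Qed.

Lemma is_derive_sqr (R : realType) (f : R -> R) (x df : R) :
  is_derive x 1 f df -> is_derive x 1 (fun u => f u ^+ 2) (2 * f x * df).
Proof.
move=> fd; have -> : (fun u => f u ^+ 2) = f * f by apply/funext => u; rewrite expr2.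
by apply: (is_derive_eq (is_deriveM fd fd)); rewrite /GRing.scale/=; ring.
Qed.

Lemma exists_half_pow_lt (R : realType) (M e : R) : 0 < e -> exists k, M / 2 ^+ k < e.
Proof.
move=> e0; exists (Num.bound (M / e)).
by rewrite ltr_pdivrMr ?exprn_gt0// mulrC -ltr_pdivrMr//; exact: upper_nthrootP.
Qed.

Lemma half_pow_eq0 (R : realType) (M x : R) : (forall k, `|x| <= M / 2 ^+ k) -> x = 0.
Proof.
move=> H; apply/eqP/negPn/negP => x0.
have x0' : 0 < `|x| by rewrite normr_gt0.
have [k] := exists_half_pow_lt M x0'.
by rewrite ltNge H.
Qed.

Lemma geometric_cauchy (R : realType) (a : nat -> R) (M : R) :
  (forall k, `|a k.+1 - a k| <= M / 2 ^+ k) ->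
  exists l, forall k, `|l - a k| <= 2 * M / 2 ^+ k.
Proof.
move=> H; pose b k := a k - 2 * M / 2 ^+ k; pose c k := a k + 2 * M / 2 ^+ k.
have M0 : 0 <= M by have := le_trans (normr_ge0 _) (H 0%N); rewrite expr0 divr1.
have E k : 2 * M / 2 ^+ k.+1 = M / 2 ^+ k.
  by rewrite exprS invfM; field; rewrite expf_neq0.
have E2 k : 2 * M / 2 ^+ k = M / 2 ^+ k + M / 2 ^+ k by ring.
have bS k : b k <= b k.+1.
  by have := H k; have := E2 k; rewrite ler_norml /b E => ? /andP[]; lra.
have cS k : c k.+1 <= c k.
  by have := H k; have := E2 k; rewrite ler_norml /c E => ? /andP[]; lra.
have bm : {homo b : i j / (i <= j)%N >-> i <= j}.
  by apply: homo_leq => // ? ? ?; exact: le_trans.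
have cm : {homo c : i j / (i <= j)%N >-> j <= i}.
  by apply: (homo_leq (r := fun x y => y <= x)) => // y x z yx zy; exact: le_trans zy yx.
have bc i : b i <= c i.
  by rewrite /b /c lerBlDr -addrA lerDl addr_ge0// divr_ge0 ?exprn_ge0// mulr_ge0.
have bcij i j : b i <= c j.
  case: (leqP i j) => ij.
    exact: le_trans (bm _ _ ij) (bc j).
  exact: le_trans (bc i) (cm _ _ (ltnW ij)).
exists (sup (range b)) => k; rewrite ler_norml.
have ub : b k <= sup (range b).
  apply: ub_le_sup; last by exists k.
  by exists (c 0%N) => _ [i _ <-].
have lb : sup (range b) <= c k.
  by apply: ge_sup; [exists (b 0%N); exists 0%N|move=> _ [i _ <-]].
by apply/andP; split; [rewrite /b in ub; lra|rewrite /c in lb; lra].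
Qed.

Definition flow_of (R : realType) (m : nat) (G : 'rV[R]_m -> 'rV[R]_m)
    (Y : R -> 'rV[R]_m) : Prop :=
  cts_pos Y /\
  forall u : R, 0 < u -> forall i, is_derive u 1 (fun v => Y v 0 i) (G (Y u) 0 i).

Section Picard.
Variables (R : realType) (m : nat) (G : 'rV[R]_m -> 'rV[R]_m) (K : R).
Hypothesis K0 : 0 < K.
Hypothesis LG : forall x y, `|G x - G y| <= K * `|x - y|.

Lemma lip_continuous : continuous G.
Proof.
move=> x; apply/(@cvgrPdist_lt _ _ _ _ (nbhs_filter x)) => e e0.
near=> y; apply: le_lt_trans (LG _ _) _.
rewrite mulrC -ltr_pdivlMr//; near: y.
by apply: (@cvgr_dist_lt _ _ _ _ (nbhs_filter x) id x) => //; rewrite divr_gt0.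
Unshelve. all: by end_near. Qed.

Lemma lip_coord_cts (Y : R -> 'rV[R]_m) i :
  cts_pos Y -> cts_pos (fun u => G (Y u) 0 i).
Proof.
move=> cY.
apply: (@cts_pos_comp _ _ _ (fun y => G y 0 i) Y) => // x.
exact: (cvg_comp G (fun y => y 0 i) (lip_continuous (x := x))
  (@coord_continuous _ _ _ 0 i (G x))).
Qed.

Variable y0 : 'rV[R]_m.

Definition picard_step (Y : R -> 'rV[R]_m) (u : R) : 'rV[R]_m :=
  \row_i (y0 0 i + primitive (fun z => G (Y z) 0 i) u).

Lemma picard_step_derive (Y : R -> 'rV[R]_m) (u : R) i : cts_pos Y -> 0 < u ->
  is_derive u 1 (fun v => picard_step Y v 0 i) (G (Y u) 0 i).
Proof.
move=> cY u0.
have -> : (fun v => picard_step Y v 0 i) =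
          (fun v => y0 0 i + primitive (fun z => G (Y z) 0 i) v).
  by apply/funext => v; rewrite mxE.
rewrite -[X in is_derive _ _ _ X]add0r.
have c0 : is_derive u (1 : R) (fun=> y0 0 i) (0 : R) by exact: is_derive_cst.
exact: is_deriveD c0 (primitive_derive (lip_coord_cts (i := i) cY) u0).
Qed.

Lemma picard_step_cts (Y : R -> 'rV[R]_m) : cts_pos Y -> cts_pos (picard_step Y).
Proof.
move=> cY; apply/cts_row => i.
have -> : (fun v => picard_step Y v 0 i) =
          (fun v => y0 0 i + primitive (fun z => G (Y z) 0 i) v).
  by apply/funext => v; rewrite mxE.
apply: cts_posD; [exact: cts_pos_cst|exact/primitive_cts/lip_coord_cts].
Qed.

Lemma picard_step0 Y : picard_step Y 0 = y0.
Proof. by apply/rowP => i; rewrite mxE primitive0 addr0. Qed.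

(* The weight [expR (2 * K * u)] makes each Picard step halve distances on the
   whole half-line. *)
Lemma picard_step_contraction (Y Z : R -> 'rV[R]_m) (C : R) :
  cts_pos Y -> cts_pos Z -> 0 <= C ->
  (forall u : R, 0 <= u -> `|Y u - Z u| <= C * expR (2 * K * u)) ->
  forall u : R, 0 <= u ->
    `|picard_step Y u - picard_step Z u| <= C / 2 * expR (2 * K * u).
Proof.
move=> cY cZ C0 H u u0; apply/rV_norm_le.
  by rewrite mulr_ge0 ?expR_ge0// divr_ge0.
move=> i; rewrite !mxE.
pose f v := picard_step Y v 0 i - picard_step Z v 0 i.
pose g v : R := C / 2 * expR (2 * K * v).
have cs W : cts_pos W -> cts_pos (fun v => picard_step W v 0 i).
  by move=> cW; have /cts_row := picard_step_cts cW; apply.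
have := @le_diff_pos R f (fun v => G (Y v) 0 i - G (Z v) 0 i)
  g (fun v => K * (C * expR (2 * K * v))) 0 u.
rewrite /f !picard_step0 subrr subr0 !mxE /g mulr0 expR0 mulr1 => F.
have : 0 <= C / 2 by rewrite divr_ge0.
move=> ?; apply: le_trans (F _ _ _ _ _ _ _) _ => //.
- by apply: cts_posB; exact: cs.
- by move=> v v0; apply: is_deriveB; exact: picard_step_derive.
- by apply: cts_posM; [exact: cts_pos_cst|exact: expRM_cts_pos].
- move=> v v0.
  have -> : K * (C * expR (2 * K * v)) = C / 2 * (2 * K * expR (2 * K * v)) by field.
  exact: is_deriveZ (is_derive_expRM _ _).
- move=> v v0 _; have := LG (Y v) (Z v).
  move=> /le_trans/(_ (ler_wpM2l (ltW K0) (H v (ltW v0)))).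
  move/rV_norm_le; rewrite mulr_ge0 ?mulr_ge0 ?expR_ge0 ?(ltW K0)// => /(_ isT i).
  by rewrite !mxE.
- by rewrite gerBl.
Qed.

Fixpoint picard_iter k : R -> 'rV[R]_m :=
  if k is k'.+1 then picard_step (picard_iter k') else fun=> y0.

Lemma picard_iter_cts (k : nat) : cts_pos (picard_iter k).
Proof.
by elim: k => [|k IH]; [exact: cts_pos_cst|exact: picard_step_cts].
Qed.

Let C := `|G y0| / (2 * K).

Let C0 : 0 <= C. Proof. by rewrite divr_ge0// mulr_ge0// ltW. Qed.

Lemma picard_iter_diff k (u : R) : 0 <= u ->
  `|picard_iter k.+1 u - picard_iter k u| <= C / 2 ^+ k * expR (2 * K * u).
Proof.
elim: k u => [|k IH] u u0.
  rewrite expr0 divr1 /=; apply/rV_norm_le; first by rewrite mulr_ge0 ?expR_ge0.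
  move=> i; rewrite !mxE addrAC subrr add0r.
  have := @le_diff_pos R (primitive (fun=> G y0 0 i)) (fun=> G y0 0 i)
    (fun v => `|G y0| * v) (fun=> `|G y0|) 0 u.
  rewrite primitive0 !mulr0 !subr0 => F.
  apply: le_trans (F _ _ _ _ _ _ _) _ => //.
  - exact/primitive_cts/cts_pos_cst.
  - by move=> v v0; apply: primitive_derive v0; exact: cts_pos_cst.
  - by apply: cts_posM; [exact: cts_pos_cst|apply: continuous_subspaceT => ?; exact: cvg_id].
  - move=> v v0; rewrite -[X in is_derive _ _ _ X]mulr1; exact: is_deriveZ.
  - by move=> v _ _; have /rV_norm_le := lexx `|G y0|; apply.
  - rewrite /C mulrAC ler_pdivlMr ?mulr_gt0//.
    have -> : `|G y0| * u * (2 * K) = `|G y0| * (2 * K * u) by ring.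
    apply: ler_wpM2l => //; apply: le_trans (expR_ge1Dx _).
    by rewrite lerDr.
have -> : C / 2 ^+ k.+1 = C / 2 ^+ k / 2.
  by rewrite exprSr invfM mulrA.
apply: (picard_step_contraction (Y := picard_iter k.+1) (Z := picard_iter k)) u0.
- exact: (@picard_iter_cts k.+1).
- exact: picard_iter_cts.
- by rewrite divr_ge0 ?exprn_ge0.
- exact: IH.
Qed.

Theorem flow_exists : exists2 Y, flow_of G Y & Y 0 = y0.
Proof.
have /choice[l Hl] : forall x : R * 'I_m, exists l, 0 <= x.1 -> forall k,
    `|l - picard_iter k x.1 0 x.2| <= 2 * (C * expR (2 * K * x.1)) / 2 ^+ k.
  move=> [u i]/=.
  have [u0|u0] := leP 0 u; last by exists 0.
  have H k : `|picard_iter k.+1 u 0 i - picard_iter k u 0 i| <=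
      C * expR (2 * K * u) / 2 ^+ k.
    have D0 : 0 <= C / 2 ^+ k * expR (2 * K * u).
      by rewrite mulr_ge0 ?expR_ge0// divr_ge0 ?exprn_ge0.
    have /(rV_norm_le _ D0)/(_ i) := picard_iter_diff k u0.
    by rewrite !mxE mulrAC.
  by have [l Hl] := geometric_cauchy H; exists l.
pose Y (u : R) : 'rV_m := \row_i l (u, i).
have YP k u : 0 <= u -> `|Y u - picard_iter k u| <= 2 * C / 2 ^+ k * expR (2 * K * u).
  move=> u0; apply/rV_norm_le.
    by rewrite mulr_ge0 ?expR_ge0// divr_ge0 ?exprn_ge0// mulr_ge0.
  move=> i; rewrite !mxE; apply: le_trans (Hl (u, i) u0 k) _.
  by rewrite le_eqVlt; apply/orP; left; apply/eqP; rewrite /=; ring.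
have cY : cts_pos Y.
  apply/cts_row => i; apply/ctsP => u u0 e e0.
  have e3 : 0 < e / 3 by rewrite divr_gt0.
  have [k Hk] := exists_half_pow_lt (2 * C * expR (2 * K * (u + 1))) e3.
  have /cts_row/(_ i)/ctsP/(_ u u0 _ e3)[d d0 Hd] := @picard_iter_cts k.
  have YPi v : 0 <= v -> v <= u + 1 -> `|Y v 0 i - picard_iter k v 0 i| < e / 3.
    move=> v0 vu; apply: le_lt_trans Hk.
    have D0 : 0 <= 2 * C / 2 ^+ k * expR (2 * K * v).
      by rewrite mulr_ge0 ?expR_ge0// divr_ge0 ?exprn_ge0// mulr_ge0.
    have /(rV_norm_le _ D0)/(_ i) := YP k v v0.
    rewrite 2!mxE [X in _ + X]mxE => /le_trans; apply.
    rewrite mulrAC; apply: ler_wpM2r; first by rewrite invr_ge0 exprn_ge0.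
    apply: ler_wpM2l; first by rewrite mulr_ge0.
    by rewrite ler_expR ler_wpM2l// mulr_ge0// ltW.
  exists (Num.min d 1); first by rewrite lt_min d0/=.
  move=> v v0; rewrite lt_min => /andP[uvd uv1].
  have vu : v <= u + 1 by move: uv1; rewrite distrC ltr_norml => /andP[_]; lra.
  have := YPi v v0 vu; have := YPi u u0; rewrite lerDl ler01 => /(_ isT).
  have := Hd v v0 uvd; rewrite !ltr_norml => /andP[? ?] /andP[? ?] /andP[? ?].
  by apply/andP; split; lra.
have YE u : 0 <= u -> Y u = picard_step Y u.
  move=> u0; apply/eqP; rewrite -subr_eq0 -normr_eq0; apply/eqP.
  apply: (@half_pow_eq0 _ (2 * C * expR (2 * K * u))) => k; rewrite normr_id.
  have C1 : 0 <= 2 * C / 2 ^+ k by rewrite divr_ge0 ?exprn_ge0// mulr_ge0.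
  have := picard_step_contraction cY (@picard_iter_cts k) C1 (YP k) u0.
  have := YP k.+1 u u0 => /=.
  move=> h1 h2; apply: le_trans (ler_distD (picard_iter k.+1 u) _ _) _ => /=.
  rewrite [X in _ + X]distrC; apply: le_trans (lerD h1 h2) _.
  rewrite exprSr invfM le_eqVlt; apply/orP; left; apply/eqP.
  by field; rewrite expf_neq0.
exists Y; last by rewrite YE ?picard_step0.
split=> // u u0 i.
apply: (is_derive_eq_pos _ u0 (picard_step_derive i cY u0)) => v v0.
by rewrite -YE.
Qed.

Lemma flow_gronwall X Z (u : R) : flow_of G X -> flow_of G Z ->
  0 <= u -> `|X u - Z u| <= m%:R * expR (m%:R * K * u) * `|X 0 - Z 0|.
Proof.
move=> [cX dX] [cZ dZ] u0.
pose w i v := X v 0 i - Z v 0 i.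
pose W v := \sum_i w i v ^+ 2.
pose dW v := \sum_i (2 * w i v * (G (X v) 0 i - G (Z v) 0 i)).
have wD i (v : R) : 0 < v -> is_derive v 1 (w i) (G (X v) 0 i - G (Z v) 0 i).
  by move=> v0; apply: is_deriveB; [exact: dX|exact: dZ].
have cw i : cts_pos (w i).
  by apply: cts_posB; [move/cts_row: cX; apply|move/cts_row: cZ; apply].
have cW : cts_pos W by apply: cts_pos_sum => i _; exact: cts_posX.
have wn i (v : R) : `|w i v| <= `|X v - Z v|.
  have /rV_norm_le := lexx `|X v - Z v|.
  by move=> /(_ (normr_ge0 _) i); rewrite !mxE.
have W_ge0 (v : R) : 0 <= W v by apply: sumr_ge0 => i _; exact: sqr_ge0.
have nW (v : R) : `|X v - Z v| ^+ 2 <= W v.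
  rewrite -[leRHS]sqr_sqrtr// lerXn2r ?nnegrE ?sqrtr_ge0//.
  apply/rV_norm_le; first exact: sqrtr_ge0.
  move=> i; rewrite !mxE -sqrtr_sqr ler_sqrt//.
  by rewrite /W (bigD1 i)//= lerDl; apply: sumr_ge0 => j _; exact: sqr_ge0.
have Wn (v : R) : W v <= m%:R * `|X v - Z v| ^+ 2.
  apply: sum_ord_le => i.
  by rewrite -real_normK ?num_real// lerXn2r ?nnegrE.
have WD (v : R) : 0 < v -> is_derive v 1 W (dW v).
  move=> v0.
  have -> : W = \sum_i (fun x => w i x ^+ 2) by apply/funext => x; rewrite fct_sumE.
  by apply: is_derive_sum => i; exact: is_derive_sqr (wD i v v0).
have dWW (v : R) : dW v <= 2 * (m%:R * K) * W v.
  have -> : 2 * (m%:R * K) * W v = m%:R * (2 * K * W v) by ring.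
  apply: sum_ord_le => i.
  apply: le_trans (ler_norm _) _; rewrite !normrM -!mulrA ger0_norm// ler_wpM2l//.
  apply: (@le_trans _ _ (`|X v - Z v| * (K * `|X v - Z v|))).
    apply: ler_pM => //.
    have := LG (X v) (Z v); move/rV_norm_le; rewrite mulr_ge0 ?(ltW K0)// => /(_ isT i).
    by rewrite !mxE.
  by rewrite mulrCA ler_wpM2l ?(ltW K0)// -expr2.
have {dWW} WE : W u <= W 0 * expR (2 * (m%:R * K) * u).
  pose f v := - (W v * expR (- (2 * (m%:R * K)) * v)).
  have : f 0 <= f u.
    apply: (@ndecr_pos _ _ (fun v => - (dW v - 2 * (m%:R * K) * W v) *
        expR (- (2 * (m%:R * K)) * v)) 0 u) => //.
    - apply: (cts_pos_comp (@oppr_continuous _ _)).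
      by apply: cts_posM; [|exact: expRM_cts_pos].
    - move=> v v0.
      apply: (is_derive_eq (is_deriveN (is_deriveM (WD v v0) (is_derive_expRM _ _)))).
      by rewrite /GRing.scale/=; ring.
    - by move=> v v0 _; rewrite mulr_ge0 ?expR_ge0// oppr_ge0 subr_le0.
  rewrite /f lerN2 mulr0 expR0 mulr1 mulNr expRN ler_pdivrMr ?expR_gt0//.
case: (posnP m) => [m0|m0].
  have -> : X u - Z u = 0.
    by apply/rowP => i; exfalso; case: i => i /= im; move: im; rewrite m0.
  by rewrite normr0 mulr_ge0 ?mulr_ge0 ?expR_ge0.
rewrite -(@ler_pXn2r _ 2) ?nnegrE// ?mulr_ge0 ?expR_ge0//.
apply: le_trans (nW u) _; apply: le_trans WE _.
have -> : expR (2 * (m%:R * K) * u) = expR (m%:R * K * u) ^+ 2.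
  by rewrite expr2 -expRD; congr expR; ring.
rewrite !exprMn [leRHS]mulrAC; apply: ler_wpM2r; first exact: sqr_ge0.
apply: le_trans (Wn 0) _; rewrite ler_wpM2r ?sqr_ge0//.
by rewrite -natrX ler_nat -[leqLHS]expn1 leq_pexp2l.
Qed.

End Picard.

(** * Stable manifolds by the cone condition *)

Section Dot.
Variables (R : realType) (m : nat) (c : 'I_m -> R).
Implicit Types x y z : 'rV[R]_m.

Definition dot x y : R := \sum_i c i * x 0 i * y 0 i.

Lemma dotC x y : dot x y = dot y x.
Proof. by apply: eq_bigr => i _; rewrite mulrAC. Qed.

Lemma dotDl x y z : dot (x + y) z = dot x z + dot y z.
Proof. by rewrite /dot -big_split/=; apply: eq_bigr => i _; rewrite mxE; ring. Qed.

Lemma dotZl k x z : dot (k *: x) z = k * dot x z.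
Proof. by rewrite /dot mulr_sumr; apply: eq_bigr => i _; rewrite mxE; ring. Qed.

Lemma dotNl x z : dot (- x) z = - dot x z.
Proof. by rewrite -scaleN1r dotZl mulN1r. Qed.

Lemma dotDr x y z : dot x (y + z) = dot x y + dot x z.
Proof. by rewrite dotC dotDl !(dotC x). Qed.

Lemma dotZr k x z : dot x (k *: z) = k * dot x z.
Proof. by rewrite dotC dotZl dotC. Qed.

Lemma dotNr x z : dot x (- z) = - dot x z.
Proof. by rewrite dotC dotNl dotC. Qed.

Definition dotE := (dotDl, dotDr, dotZl, dotZr, dotNl, dotNr).

Hypothesis c1 : forall i, 1 <= c i.

Let c0 i : 0 <= c i. Proof. exact: le_trans ler01 (c1 i). Qed.

Lemma dot_ge0 x : 0 <= dot x x.
Proof. by apply: sumr_ge0 => i _; rewrite -mulrA -expr2 mulr_ge0 ?sqr_ge0. Qed.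

Lemma coord_le_dot x i : x 0 i ^+ 2 <= dot x x.
Proof.
rewrite /dot (bigD1 i)//= -[leLHS]addr0 lerD//.
  by rewrite -mulrA -expr2 ler_peMl ?sqr_ge0.
by apply: sumr_ge0 => j _; rewrite -mulrA -expr2 mulr_ge0 ?sqr_ge0.
Qed.

Lemma norm_le_dot x D : 0 <= D -> dot x x <= D ^+ 2 -> `|x| <= D.
Proof.
move=> D0 xD; apply/rV_norm_le => // i.
by rewrite -ler_sqr ?nnegrE// real_normK ?num_real// (le_trans (coord_le_dot x i)).
Qed.

Lemma sqr_dot_le e x : dot e e = 1 -> dot e x ^+ 2 <= dot x x.
Proof.
move=> e1; have := dot_ge0 (x + (- dot e x) *: e).
rewrite !dotE e1 (dotC x e); set b := dot e x; set a := dot x x.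
by move=> H; rewrite -subr_ge0; move: H; congr (0 <= _); ring.
Qed.

Lemma dot_cts_pos (f g : R -> 'rV[R]_m) :
  cts_pos f -> cts_pos g -> cts_pos (fun u => dot (f u) (g u)).
Proof.
move=> /cts_row cf /cts_row cg; apply: cts_pos_sum => i _.
by apply: cts_posM; [apply: cts_posM; [exact: cts_pos_cst|exact: cf]|exact: cg].
Qed.

Lemma dot_derive (f g df dg : R -> 'rV[R]_m) (u : R) :
  (forall i, is_derive u 1 (fun v => f v 0 i) (df u 0 i)) ->
  (forall i, is_derive u 1 (fun v => g v 0 i) (dg u 0 i)) ->
  is_derive u 1 (fun v => dot (f v) (g v)) (dot (df u) (g u) + dot (f u) (dg u)).
Proof.
move=> fd gd.
have -> : (fun v => dot (f v) (g v)) =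
    \sum_i (fun v => c i * f v 0 i * g v 0 i).
  by apply/funext => v; rewrite fct_sumE.
rewrite /dot -big_split/=; apply: is_derive_sum => i.
have fi : is_derive u 1 (fun v => c i * f v 0 i) (c i * df u 0 i).
  exact: is_deriveZ (fd i).
by apply: (is_derive_eq (is_deriveM fi (gd i))); rewrite /GRing.scale/=; ring.
Qed.

End Dot.

Lemma dot_continuous (R : realType) (m : nat) (c : 'I_m -> R) (T : topologicalType)
    (f g : T -> 'rV[R]_m) :
  continuous f -> continuous g -> continuous (fun t => dot c (f t) (g t)).
Proof.
move=> cf cg.
have -> : (fun t => dot c (f t) (g t)) = \sum_i (fun t => c i * f t 0 i * g t 0 i).
  by apply/funext => v; rewrite fct_sumE.
have H (h : T -> 'rV[R]_m) i : continuous h -> continuous (fun t => h t 0 i).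
  move=> ch t; exact: (cvg_comp h (fun y => y 0 i) (ch t) (@coord_continuous _ _ _ 0 i (h t))).
apply: (big_ind (fun h : T -> R => continuous h)) => [|h1 h2 c1 c2 t|i _ t].
- exact: cst_continuous.
- by apply: cvgD; [exact: c1|exact: c2].
- by apply: cvgM; [apply: cvgM; [exact: cvg_cst|exact: H]|exact: H].
Qed.

Lemma continuous_affine (R : realType) (m : nat) (T : topologicalType)
    (v e : 'rV[R]_m) (f : T -> 'rV[R]_m) (g : T -> R) :
  continuous f -> continuous g -> continuous (fun t => v + f t + g t *: e).
Proof.
move=> cf cg t; apply: cvgD; last by apply: cvgZr_tmp; exact: cg.
by apply: cvgD; [exact: cvg_cst|exact: cf].
Qed.

Lemma continuous_subr (R : realType) (m : nat) (T : topologicalType)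
    (f : T -> 'rV[R]_m) (b : 'rV[R]_m) :
  continuous f -> continuous (fun t => f t - b).
Proof. by move=> cf t; apply: cvgB; [exact: cf|exact: cvg_cst]. Qed.

Section Shooting.
Variables (R : realType) (m : nat) (c : 'I_m -> R) (G : 'rV[R]_m -> 'rV[R]_m).
Variables (th : {set 'I_m}) (e : 'rV[R]_m) (k : R).
Hypothesis c1 : forall i, 1 <= c i.
Hypothesis e1 : dot c e e = 1.
Hypothesis k0 : 0 < k.
Local Notation "<< x , y >>" := (dot c x y).

Definition supported (x : 'rV[R]_m) := forall i, i \notin th -> x 0 i = 0.

Hypothesis eth : supported e.
Hypothesis Gth : forall x, supported (G x).
Hypothesis expand : forall x y, supported (x - y) ->
  2 * k * << e, x - y >> ^+ 2 - k / 2 * << x - y, x - y >> <=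
  2 * << e, x - y >> * << e, G x - G y >>.
Hypothesis contract : forall x y, supported (x - y) ->
  2 * << x - y, G x - G y >> - 2 * << e, x - y >> * << e, G x - G y >> <=
  - (2 * k) * (<< x - y, x - y >> - << e, x - y >> ^+ 2) + k / 2 * << x - y, x - y >>.

Definition unst (x : 'rV[R]_m) : R := << e, x >> ^+ 2.
Definition stab (x : 'rV[R]_m) : R := << x, x >> - << e, x >> ^+ 2.
Definition cone (x : 'rV[R]_m) : R := unst x - stab x.

Lemma stab_ge0 x : 0 <= stab x.
Proof. by rewrite subr_ge0 sqr_dot_le. Qed.

Section Difference.
Variables X Z : R -> 'rV[R]_m.
Hypothesis fX : flow_of G X.
Hypothesis fZ : flow_of G Z.
Hypothesis XZ0 : supported (X 0 - Z 0).

Let w u := X u - Z u.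

Let cw : cts_pos w.
Proof.
case: fX fZ => cX _ [cZ _] x; apply: cvgB; [exact: cX|exact: cZ].
Qed.

Let dw (u : R) : 0 < u -> forall i,
  is_derive u 1 (fun v => w v 0 i) ((G (X u) - G (Z u)) 0 i).
Proof.
move=> u0 i; have -> : (fun v => w v 0 i) = (fun v => X v 0 i - Z v 0 i).
  by apply/funext => v; rewrite !mxE.
by rewrite !mxE; apply: is_deriveB; [exact: fX.2|exact: fZ.2].
Qed.

Lemma difference_supported (u : R) : 0 <= u -> supported (X u - Z u).
Proof.
move=> u0 i ith; have := XZ0 ith.
have /cts_row/(_ i) cwi := cw.
have H : forall v : R, 0 < v -> is_derive v 1 (fun v => w v 0 i) 0.
  by move=> v v0; have := dw v0 i; rewrite !mxE !Gth// subr0.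
have F := le_diff_pos cwi H (@cts_pos_cst R R 0)
  (fun v _ => is_derive_cst (0 : R) v (1 : R)) (lexx 0) u0.
have : `|w u 0 i - w 0 0 i| <= 0 - 0 by apply: F => v _ _; rewrite normr0.
by rewrite subrr normr_le0 subr_eq0 => /eqP ->.
Qed.

Let cun : cts_pos (fun u => unst (w u)).
Proof. by apply: cts_posX; apply: dot_cts_pos => //; exact: cts_pos_cst. Qed.

Let cst : cts_pos (fun u => stab (w u)).
Proof. by apply: cts_posB cun; exact: dot_cts_pos. Qed.

Let dun (u : R) : 0 < u ->
  is_derive u 1 (fun v => unst (w v)) (2 * << e, w u >> * << e, G (X u) - G (Z u) >>).
Proof.
move=> u0; apply: is_derive_sqr.
have H i : is_derive u (1 : R) (fun v : R => e 0 i) ((0 : 'rV[R]_m) 0 i).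
  by rewrite mxE; exact: is_derive_cst.
apply: (is_derive_eq (dot_derive c (f := fun=> e) (df := fun=> 0)
  (dg := fun u => G (X u) - G (Z u)) H (dw u0))).
by rewrite -(scale0r e) dotZl mul0r add0r.
Qed.

Let dst (u : R) : 0 < u ->
  is_derive u 1 (fun v => stab (w v))
   (2 * << w u, G (X u) - G (Z u) >> - 2 * << e, w u >> * << e, G (X u) - G (Z u) >>).
Proof.
move=> u0; apply: is_deriveB (dun u0).
apply: (is_derive_eq (dot_derive c (df := fun u => G (X u) - G (Z u))
  (dg := fun u => G (X u) - G (Z u)) (dw u0) (dw u0))).
by rewrite (dotC c (G _ - _)); ring.
Qed.

Let cQ : cts_pos (fun u => cone (w u)).
Proof. exact: cts_posB. Qed.

Lemma cone_ndecr (a b : R) : 0 <= a -> a <= b -> cone (X a - Z a) <= cone (X b - Z b).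
Proof.
move=> a0 ab.
apply: (ndecr_pos cQ (fun u u0 => is_deriveB (dun u0) (dst u0)) a0 ab) => u au _.
have u0 : 0 <= u by apply: ltW; exact: le_lt_trans au.
have := expand (difference_supported u0); have := contract (difference_supported u0).
have : 0 <= k * << w u, w u >> by rewrite mulr_ge0 ?dot_ge0// ltW.
rewrite /w; lra.
Qed.

Lemma cone_grows (u : R) : 0 <= u -> 0 <= cone (X 0 - Z 0) ->
  cone (X 0 - Z 0) * (1 + k * u) <= cone (X u - Z u).
Proof.
move=> u0 Q0.
have D0 (v : R) : 0 < v -> is_derive v (1 : R) (fun x : R => cone (X 0 - Z 0) * k * x)
    (cone (X 0 - Z 0) * k).
  by move=> _; rewrite -[X in is_derive _ _ _ X]mulr1; exact: is_deriveZ.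
have cD : cts_pos (fun x : R => cone (X 0 - Z 0) * k * x).
  by apply: cts_posM; [exact: cts_pos_cst|apply: continuous_subspaceT => ?; exact: cvg_id].
have := @ndecr_pos _ _ _ 0 u (cts_posB cQ cD)
  (fun u u0 => is_deriveB (is_deriveB (dun u0) (dst u0)) (D0 u u0)) (lexx 0) u0.
have H : forall a b d : R, (a - d * k * 0 <= b - d * k * u) -> a = d -> d * (1 + k * u) <= b.
  by move=> a b d; rewrite mulr0 subr0 => + ad; rewrite ad; lra.
move=> F; apply: (H _ _ _ (F _) erefl) => v v0 _.
have := expand (difference_supported (ltW v0)).
have := contract (difference_supported (ltW v0)).
have : k * cone (X 0 - Z 0) <= k * << w v, w v >>.
  apply: ler_wpM2l; first exact: ltW.
  apply: le_trans (cone_ndecr (lexx 0) (ltW v0)) _.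
  have := stab_ge0 (X v - Z v); rewrite /cone /unst /stab /w; lra.
rewrite /w; lra.
Qed.

Lemma stab_decay : (forall u : R, 0 <= u -> cone (X u - Z u) <= 0) ->
  forall u : R, 0 <= u -> stab (X u - Z u) <= stab (X 0 - Z 0) * expR (- k * u).
Proof.
move=> Q u u0.
have := @ndecr_pos _ _ _ 0 u (cts_pos_comp (@oppr_continuous _ _)
    (cts_posM cst (@expRM_cts_pos _ k)))
  (fun u u0 => is_deriveN (is_deriveM (dst u0) (is_derive_expRM _ _))) (lexx 0) u0.
rewrite /= mulr0 expR0 mulr1 lerN2 => F.
rewrite mulNr expRN ler_pdivlMr ?expR_gt0//; apply: F => v v0 _.
rewrite /GRing.scale/=.
have := contract (difference_supported (ltW v0)).
have := Q v (ltW v0).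
set D := 2 * _ - 2 * _ * _.
have : stab (w v) = << w v, w v >> - << e, w v >> ^+ 2 by [].
rewrite /cone /unst /w.
set S := stab _; set W := << _, _ >>; set A := << _, _ >> ^+ 2.
move=> SE AS Dle.
have : D <= - (k * S).
  have : k * A <= k * S by apply: ler_wpM2l; [exact: ltW|rewrite -subr_le0].
  move: Dle; rewrite SE; lra.
rewrite oppr_ge0 => ?.
have -> : S * (k * expR (k * v)) + expR (k * v) * D = expR (k * v) * (k * S + D) by ring.
rewrite mulr_ge0_le0 ?expR_ge0//; lra.
Qed.

End Difference.
Variables (v : 'rV[R]_m) (K : R).
Hypothesis K0 : 0 < K.
Hypothesis Gv : G v = 0.
Hypothesis LG : forall x y, `|G x - G y| <= K * `|x - y|.

Let fv : flow_of G (fun=> v).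
Proof.
split=> [|u _ i]; first exact: cts_pos_cst.
by rewrite Gv mxE; exact: is_derive_cst.
Qed.

Let stab0 x : 0 <= stab x. Proof. exact: stab_ge0. Qed.

Let cone_le x : cone x <= << x, x >>.
Proof. by have := stab0 x; rewrite /cone /unst /stab; lra. Qed.

Let dot_le_stab x : cone x <= 0 -> << x, x >> <= 2 * stab x.
Proof. by rewrite /cone /unst /stab; lra. Qed.

Let dot_sub_le x y : << x - y, x - y >> <= 2 * << x, x >> + 2 * << y, y >>.
Proof.
have := dot_ge0 c1 (x + y); rewrite !dotE (dotC c y x); lra.
Qed.

Lemma supportedD (x y : 'rV[R]_m) : supported x -> supported y -> supported (x + y).
Proof. by move=> sx sy i ith; rewrite mxE sx// sy// addr0. Qed.

Lemma supportedZ a (x : 'rV[R]_m) : supported x -> supported (a *: x).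
Proof. by move=> sx i ith; rewrite mxE sx// mulr0. Qed.

Lemma supportedB (x y : 'rV[R]_m) : supported x -> supported y -> supported (x - y).
Proof. by move=> sx sy; rewrite -scaleN1r; apply: supportedD => //; exact: supportedZ. Qed.

Lemma stays_decay (X : R -> 'rV[R]_m) : flow_of G X -> supported (X 0 - v) ->
  (forall u : R, 0 <= u -> cone (X u - v) <= 0) ->
  forall u : R, 0 <= u ->
  << X u - v, X u - v >> <= 2 * stab (X 0 - v) * expR (- k * u).
Proof.
move=> fX sX cX u u0; apply: le_trans (dot_le_stab (cX u u0)) _.
rewrite -mulrA ler_wpM2l//.
exact: stab_decay.
Qed.

Lemma stays_cone (X Z : R -> 'rV[R]_m) : flow_of G X -> flow_of G Z ->
  supported (X 0 - v) -> supported (Z 0 - v) ->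
  (forall u : R, 0 <= u -> cone (X u - v) <= 0) ->
  (forall u : R, 0 <= u -> cone (Z u - v) <= 0) ->
  cone (X 0 - Z 0) <= 0.
Proof.
move=> fX fZ sX sZ cX cZ; rewrite leNgt; apply/negP => Q0.
have E u : X u - Z u = (X u - v) - (Z u - v) by rewrite opprB addrA subrK.
have sXZ : supported (X 0 - Z 0) by rewrite E; exact: supportedB.
pose M := 4 * (stab (X 0 - v) + stab (Z 0 - v)).
have M0 : 0 <= M by rewrite mulr_ge0// addr_ge0.
have b (Y : R -> 'rV[R]_m) (u : R) : flow_of G Y -> supported (Y 0 - v) ->
    (forall u : R, 0 <= u -> cone (Y u - v) <= 0) -> 0 <= u ->
    << Y u - v, Y u - v >> <= 2 * stab (Y 0 - v).
  move=> fY sY cY u0; apply: le_trans (stays_decay fY sY cY u0) _.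
  by rewrite ler_piMr ?mulr_ge0// -expR0 ler_expR mulNr oppr_le0 mulr_ge0// ltW.
have H (u : R) : 0 <= u -> cone (X 0 - Z 0) * (1 + k * u) <= M.
  move=> u0; apply: le_trans (cone_grows fX fZ sXZ u0 (ltW Q0)) _.
  apply: le_trans (cone_le _) _; rewrite E; apply: le_trans (dot_sub_le _ _) _.
  have := b _ _ fX sX cX u0; have := b _ _ fZ sZ cZ u0; rewrite /M; lra.
have uM : 0 <= M / (cone (X 0 - Z 0) * k) by rewrite divr_ge0// mulr_ge0// ltW.
have := H _ uM.
have -> : cone (X 0 - Z 0) * (1 + k * (M / (cone (X 0 - Z 0) * k))) =
    cone (X 0 - Z 0) + M.
  by field; rewrite !gt_eqF.
by rewrite gerDr leNgt Q0.
Qed.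

Let phi y := s2val (cid2 (flow_exists K0 LG y)).

Let phiP y : flow_of G (phi y). Proof. by rewrite /phi; case: cid2. Qed.

Let phi0 y : phi y 0 = y. Proof. by rewrite /phi; case: cid2. Qed.

Let phi_lip u x y : 0 <= u ->
  `|phi x u - phi y u| <= (m%:R * expR (m%:R * K * u) + 1) * `|x - y|.
Proof.
move=> u0; rewrite -[in leRHS](phi0 x) -[in leRHS](phi0 y).
apply: le_trans (flow_gronwall K0 LG (phiP x) (phiP y) u0) _.
by rewrite ler_wpM2r// lerDl.
Qed.

Let phi_continuous (u : R) : 0 <= u -> continuous (phi^~ u).
Proof.
move=> u0; apply: (@lip_continuous _ _ _ (m%:R * expR (m%:R * K * u) + 1)).
  by rewrite ltr_wpDl// mulr_ge0 ?expR_ge0.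
by move=> x y; exact: phi_lip.
Qed.

Let base s t := v + s + t *: e.

(* The values of the e-component for which the solution enters the open cone on
   the side of sign [g]; once inside it never leaves. *)
Let escapes (s : 'rV[R]_m) (g : R) : set R := [set t | exists2 u : R, 0 <= u &
  0 < cone (phi (base s t) u - v) /\ 0 < g * << e, phi (base s t) u - v >>].

Let escapes_open s g : open (escapes s g).
Proof.
have -> : escapes s g = \bigcup_(u in [set u : R | 0 <= u])
    ([set t | 0 < cone (phi (base s t) u - v)] `&`
     [set t | 0 < g * << e, phi (base s t) u - v >>]).
  by apply/seteqP; split=> t [u u0 H]; exists u.
apply: bigcup_open => u /= u0.
have cz : continuous (fun t => phi (base s t) u - v).
  move=> t; apply: cvgB; last exact: cvg_cst.
  apply: (cvg_comp (base s) (phi^~ u)); last exact: phi_continuous.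
  by apply: cvgD; [exact: cvg_cst|apply: cvgZr_tmp; exact: cvg_id].
have ca : continuous (fun t => << e, phi (base s t) u - v >>).
  by apply: dot_continuous => // x; exact: cvg_cst.
have cd := dot_continuous (c := c) cz cz.
have og (h : R -> R) : continuous h -> open [set t | 0 < h t].
  by move=> ch; apply: (open_comp (f := h) (D := [set x | 0 < x])) => // ? _; exact: ch.
apply: openI; apply: og.
- move=> t; apply: cvgB; first by apply: cvgM; exact: ca.
  by apply: cvgB; [exact: cd|apply: cvgM; exact: ca].
- by move=> t; apply: cvgM; [exact: cvg_cst|exact: ca].
Qed.

Let base_subv (s : 'rV[R]_m) t : base s t - v = s + t *: e.
Proof. by rewrite /base addrC !addrA addNr add0r. Qed.

Let base_supported (s : 'rV[R]_m) t : supported s -> supported (base s t - v).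
Proof.
by move=> ss; rewrite base_subv; apply: supportedD => //; exact: supportedZ.
Qed.

Let dot_base (s : 'rV[R]_m) t : << e, s >> = 0 -> << e, base s t - v >> = t.
Proof. by move=> es; rewrite base_subv !dotE es e1 add0r mulr1. Qed.

Let stab_base (s : 'rV[R]_m) t : << e, s >> = 0 -> stab (base s t - v) = << s, s >>.
Proof.
move=> es; rewrite /stab dot_base// base_subv !dotE (dotC c s e) es e1; ring.
Qed.

Let cone_base0 (s : 'rV[R]_m) t :
  << e, s >> = 0 -> cone (base s t - v) = t ^+ 2 - << s, s >>.
Proof. by move=> es; rewrite /cone stab_base// /unst dot_base. Qed.

Let cone_unst_neq0 x : 0 < cone x -> << e, x >> != 0.
Proof.
move=> Q0; apply/eqP => a0; move: Q0.
by rewrite /cone /unst a0 expr0n/= sub0r oppr_gt0 ltNge stab0.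
Qed.

Let escapes_disjoint (s : 'rV[R]_m) t :
  supported s -> escapes s 1 t -> escapes s (-1) t -> False.
Proof.
move=> ss [u1 u10 [Q1 a1]] [u2 u20 [Q2 a2]].
rewrite mul1r in a1; rewrite mulN1r oppr_gt0 in a2.
pose f u := << e, phi (base s t) u - v >>.
have cf : cts_pos f.
  apply: dot_cts_pos; first exact: cts_pos_cst.
  by move=> x; apply: cvgB; [exact: (phiP _).1|exact: cvg_cst].
have sp : supported (phi (base s t) 0 - v) by rewrite phi0; exact: base_supported.
have f0 (u : R) : u1 <= u \/ u2 <= u -> f u != 0.
  case=> uu; apply: cone_unst_neq0.
    exact: lt_le_trans Q1 (cone_ndecr (phiP _) fv sp u10 uu).
  exact: lt_le_trans Q2 (cone_ndecr (phiP _) fv sp u20 uu).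
have [u12|u21] := leP u1 u2.
  have [|x] := IVT u12 (@cts_pos_itv _ _ _ _ u2 cf u10) (v := 0).
    by rewrite ge_min le_max (ltW a1) (ltW a2) orbT.
  by rewrite in_itv/= => /andP[u1x _] /eqP; rewrite (negbTE (f0 _ _))//; left.
have [|x] := IVT (ltW u21) (@cts_pos_itv _ _ _ _ u1 cf u20) (v := 0).
  by rewrite ge_min le_max (ltW a1) (ltW a2) orbT.
by rewrite in_itv/= => /andP[u2x _] /eqP; rewrite (negbTE (f0 _ _))//; right.
Qed.

Let cone_base (s s' : 'rV[R]_m) (t t' : R) : << e, s >> = 0 -> << e, s' >> = 0 ->
  cone (base s t - base s' t') = (t - t') ^+ 2 - << s - s', s - s' >>.
Proof.
move=> es es'.
have -> : base s t - base s' t' = base (s - s') (t - t') - v.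
  by rewrite base_subv /base scalerBl; apply/rowP => i; rewrite !mxE; ring.
by rewrite cone_base0// !dotE es es' subr0.
Qed.

Lemma exists_staying (s : 'rV[R]_m) : supported s -> << e, s >> = 0 ->
  exists t, forall u : R, 0 <= u -> cone (phi (base s t) u - v) <= 0.
Proof.
move=> ss es; apply: contrapT => H.
have cover t : escapes s 1 t \/ escapes s (-1) t.
  have [u u0 Q0] : exists2 u : R, 0 <= u & 0 < cone (phi (base s t) u - v).
    apply: contrapT => H2; apply: H; exists t => u u0.
    by rewrite leNgt; apply/negP => Q0; apply: H2; exists u.
  have := cone_unst_neq0 Q0; rewrite neq_lt => /orP[a0|a0]; [right|left].
    by exists u => //; rewrite mulN1r oppr_gt0.
  by exists u => //; rewrite mul1r.
pose a := 1 + << s, s >>.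
have a0 : 0 < a by rewrite ltr_pwDl ?dot_ge0.
have Qa : 0 < a ^+ 2 - << s, s >>.
  have := dot_ge0 c1 s => ss0.
  have -> : a ^+ 2 - << s, s >> = 1 + << s, s >> + << s, s >> ^+ 2 by rewrite /a; ring.
  by rewrite ltr_pwDl ?sqr_ge0// ltr_pwDl.
have up : escapes s 1 a.
  by exists 0 => //; rewrite phi0 cone_base0// dot_base// mul1r.
have down : escapes s (-1) (- a).
  by exists 0 => //; rewrite phi0 cone_base0// dot_base// mulrNN mul1r sqrrN.
have cT : connected [set: R] by apply/connected_intervalP.
have : escapes s 1 = [set: R].
  apply: cT; first by exists a.
  - by exists (escapes s 1); [exact: escapes_open|rewrite setTI].
  - exists (~` escapes s (-1)); first exact/open_closedC/escapes_open.
    rewrite setTI; apply/seteqP; split=> [t H1 H2|t H2].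
      exact: escapes_disjoint H1 H2.
    by case: (cover t).
move/seteqP => [_ /(_ (- a) I)] H1; exact: escapes_disjoint H1 down.
Qed.

Definition stays (s : 'rV[R]_m) (t : R) := forall u : R, 0 <= u ->
  cone (phi (base s t) u - v) <= 0.

Let graph (s : 'rV[R]_m) : R := xget 0 (stays s).

Let graphP (s : 'rV[R]_m) : supported s -> << e, s >> = 0 -> stays s (graph s).
Proof. by move=> ss es; exact: xgetPex (exists_staying ss es). Qed.

Let graph_lip (s s' : 'rV[R]_m) :
  supported s -> << e, s >> = 0 -> supported s' -> << e, s' >> = 0 ->
  (graph s - graph s') ^+ 2 <= << s - s', s - s' >>.
Proof.
move=> ss es ss' es'.
have := stays_cone (phiP _) (phiP _) _ _ (graphP ss es) (graphP ss' es').
rewrite !phi0 cone_base// subr_le0; apply; exact: base_supported.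
Qed.

Variables (d : nat) (sigma : 'rV[R]_d -> 'rV[R]_m) (r : R).
Hypothesis sigma_continuous : continuous sigma.
Hypothesis sigma_inj : injective sigma.
Hypothesis sigma_supported : forall s, supported (sigma s).
Hypothesis sigma_orth : forall s, << e, sigma s >> = 0.
Hypothesis r0 : 0 < r.
Hypothesis sigma_norm : forall s, << sigma s, sigma s >> = r ^+ 2.

Let start s := base (sigma s) (graph (sigma s)).

Let start_continuous : continuous start.
Proof.
apply: continuous_affine => // s.
have E : << sigma t - sigma s, sigma t - sigma s >> @[t --> s] --> (0 : R).
  rewrite -[X in _ --> X](_ : << sigma s - sigma s, sigma s - sigma s >> = 0); last first.
    by rewrite subrr -(scale0r e) dotZl mul0r.
  have cs := continuous_subr (b := sigma s) sigma_continuous.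
  exact: (dot_continuous (c := c) cs cs).
apply/(@cvgrPdist_lt _ _ _ _ (nbhs_filter s)) => x x0; near=> t.
rewrite -ltr_sqr ?nnegrE// ?(ltW x0)// real_normK ?num_real//.
rewrite -sqrrN opprB; apply: le_lt_trans (graph_lip _ _ _ _) _ => //.
near: t.
have /(@cvgrPdist_lt _ _ _ _ (nbhs_filter s))/(_ _ (exprn_gt0 2 x0)) := E.
by apply: filterS => t; rewrite sub0r normrN ger0_norm// dot_ge0.
Unshelve. all: by end_near. Qed.

Theorem stable_manifold_family :
  exists Phi : 'rV[R]_d -> R -> 'rV[R]_m,
  [/\ {within setT `*` `[0, +oo[, continuous (fun z => Phi z.1 z.2)},
      forall s, flow_of G (Phi s) /\ ~ (forall u : R, 0 <= u -> Phi s u = Phi s 0),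
      forall s s', same_flow_line (Phi s) (Phi s') -> s = s',
      forall s (u : R), 0 <= u -> supported (Phi s u - v) &
      forall s (u : R), 0 <= u ->
        << Phi s u - v, Phi s u - v >> <= 2 * r ^+ 2 * expR (- k * u)].
Proof.
exists (fun s => phi (start s)).
have P0 s : supported (phi (start s) 0 - v) by rewrite phi0; exact: base_supported.
have st s : forall u : R, 0 <= u -> cone (phi (start s) u - v) <= 0.
  exact: graphP.
have stab_start s : stab (phi (start s) 0 - v) = r ^+ 2.
  by rewrite phi0 stab_base.
have stab_lt s (u : R) : 0 < u -> stab (phi (start s) u - v) < r ^+ 2.
  move=> u0; have := stab_decay (phiP (start s)) fv (P0 s) (st s) (ltW u0).
  move/le_lt_trans; apply; rewrite stab_start gtr_pMr ?exprn_gt0//.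
  by rewrite -expR0 ltr_expR mulNr oppr_lt0 mulr_gt0.
have same_at s s' (u : R) : 0 <= u -> phi (start s') 0 = phi (start s) u -> s = s'.
  move=> u0 E.
  have uE : u = 0.
    apply/eqP; apply: contraT => un0.
    have : 0 < u by rewrite lt_def un0.
    by move/(stab_lt s); rewrite -E stab_start ltxx.
  apply: sigma_inj; move: E; rewrite uE !phi0 => E.
  have : base (sigma s) (graph (sigma s)) - v = base (sigma s') (graph (sigma s')) - v.
    by rewrite /start in E; rewrite E.
  move=> {}E; have := congr1 (fun x => << e, x >>) E.
  rewrite !dot_base// => gE; move: E; rewrite !base_subv gE.
  exact: addIr.
split.
- apply/subspace_continuousP => -[s u] [_ /=]; rewrite in_itv/= andbT => u0.
  apply/(@cvgrPdist_lt _ _ _ _ (within_filter _ (nbhs_filter (s, u)))) => x x0.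
  have x2 : 0 < x / 2 by rewrite divr_gt0.
  have [dl dl0 Hdl] := (ctsP _).1 (phiP (start s)).1 u u0 _ x2.
  pose C := m%:R * expR (m%:R * K * (u + 1)) + 1.
  have C0 : 0 < C by rewrite ltr_wpDl// mulr_ge0 ?expR_ge0.
  rewrite near_withinE; near=> z => -[_ /=]; rewrite in_itv/= andbT => z0.
  have uz : `|u - z.2| < Num.min dl 1.
    near: z; apply: (@cvgr_dist_lt _ _ _ _ (nbhs_filter (s, u)) snd u).
      exact: cvg_snd.
    by rewrite lt_min dl0/=.
  have sz : `|start s - start z.1| < x / 2 / C.
    near: z; apply: (@cvgr_dist_lt _ _ _ _ (nbhs_filter (s, u)) (start \o fst) (start s)).
      by apply: cvg_comp; [exact: cvg_fst|exact: start_continuous].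
    by rewrite divr_gt0.
  move: uz; rewrite lt_min => /andP[uzd uz1].
  apply: le_lt_trans (ler_distD (phi (start s) z.2) _ _) _.
  rewrite [ltRHS](splitr x); apply: ltr_leD; first exact: Hdl.
  apply: le_trans (phi_lip _ _ z0) _.
  apply: (@le_trans _ _ (C * `|start s - start z.1|)).
    apply: ler_wpM2r => //; rewrite lerD2r; apply: ler_wpM2l => //.
    rewrite ler_expR; apply: ler_wpM2l; first by rewrite mulr_ge0// ltW.
    by move: uz1; rewrite distrC ltr_norml => /andP[_]; lra.
  by rewrite mulrC -ler_pdivlMr// ltW.
- move=> s; split=> // H; have := stab_lt s 1 ltr01.
  by rewrite H// stab_start ltxx.
- move=> s s' [a a0 [H|H]].
    by apply: (same_at _ _ a a0); rewrite H ?add0r.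
  by apply/esym/(same_at _ _ a a0); rewrite H ?add0r.
- by move=> s u u0; exact: difference_supported.
- move=> s u u0; apply: le_trans (stays_decay (phiP _) (P0 s) (st s) u0) _.
  by rewrite stab_start.
Unshelve. all: by end_near. Qed.

End Shooting.

(** * The system (Y) and its linearization *)

Section System.
Variables (R : realType) (m : nat) (c P Q : 'I_m -> R).
Implicit Types x y v w : 'rV[R]_m.

Definition quad x : R := dot c x x.

Definition vf x : 'rV[R]_m :=
  \row_i (x 0 i * (quad x + Q i * x 0 i ^+ 2 - 2 * P i * x 0 i)).

(* Divided differences make the increments of the vector field exactly linear in
   [x - y], with coefficients continuous in [(x, y)]. *)
Definition secant x y (i j : 'I_m) : R :=
  (i == j)%:R * (quad x - 2 * P i * (x 0 i + y 0 i)
    + Q i * (x 0 i * x 0 i + x 0 i * y 0 i + y 0 i * y 0 i))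
  + y 0 i * (c j * (x 0 j + y 0 j)).

Lemma secantP x y i : vf x 0 i - vf y 0 i = \sum_j secant x y i j * (x - y) 0 j.
Proof.
have -> : \sum_j secant x y i j * (x - y) 0 j =
  (quad x - 2 * P i * (x 0 i + y 0 i)
    + Q i * (x 0 i * x 0 i + x 0 i * y 0 i + y 0 i * y 0 i)) * (x 0 i - y 0 i)
  + y 0 i * (quad x - quad y).
  under eq_bigr do rewrite mulrDl.
  rewrite big_split/= (bigD1 i)//= eqxx mul1r big1 ?addr0 => [|j ji].
    rewrite !mxE; congr (_ + _); rewrite /quad /dot -sumrB mulr_sumr.
    by apply: eq_bigr => j _; rewrite !mxE; ring.
  by rewrite eq_sym (negbTE ji) !mul0r.
by rewrite !mxE; ring.
Qed.

Lemma secant_continuous (T : topologicalType) (f g : T -> 'rV[R]_m) i j :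
  continuous f -> continuous g -> continuous (fun t => secant (f t) (g t) i j).
Proof.
move=> cf cg t.
have cfi k : f t 0 k @[t --> t] --> f t 0 k.
  exact: (cvg_comp f (fun y => y 0 k) (cf t) (@coord_continuous _ _ _ 0 k (f t))).
have cgi k : g t 0 k @[t --> t] --> g t 0 k.
  exact: (cvg_comp g (fun y => y 0 k) (cg t) (@coord_continuous _ _ _ 0 k (g t))).
have cq := dot_continuous (c := c) cf cf (x := t).
apply: cvgD.
  apply: cvgM; first exact: cvg_cst.
  apply: cvgD.
    apply: cvgB; first exact: cq.
    by apply: cvgM; [exact: cvg_cst|apply: cvgD].
  apply: cvgM; first exact: cvg_cst.
  by apply: cvgD; [apply: cvgD|]; apply: cvgM.
apply: cvgM => //; apply: cvgM; first exact: cvg_cst.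
exact: cvgD.
Qed.

Lemma secant_near v (a : R) : 0 < a -> exists2 rho : R, 0 < rho &
  forall x y, `|x - v| <= rho -> `|y - v| <= rho ->
  forall i j, `|secant x y i j - secant v v i j| <= a.
Proof.
move=> a0.
have : nbhs ((v, v) : 'rV[R]_m * 'rV[R]_m)
    [set z | forall ij : 'I_m * 'I_m,
      `|secant v v ij.1 ij.2 - secant z.1 z.2 ij.1 ij.2| <= a].
  apply: (@filter_forall _ _ (fun ij => [set z | `|secant v v ij.1 ij.2 -
    secant z.1 z.2 ij.1 ij.2| <= a]) _ (nbhs_filter (v, v))) => -[i j].
  have C : continuous (fun z : 'rV[R]_m * 'rV[R]_m => secant z.1 z.2 i j).
    by apply: secant_continuous => z; [exact: cvg_fst|exact: cvg_snd].
  have /(@cvgrPdist_le _ _ _ _ (nbhs_filter _))/(_ _ a0) := C (v, v).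
  by apply: filterS.
move=> /nbhs_ballP[d /= d0 H]; exists (d / 2); first by rewrite divr_gt0.
have B x : `|x - v| <= d / 2 -> ball v d x.
  move=> xv; rewrite -ball_normE/= distrC; apply: le_lt_trans xv _.
  by rewrite ltr_pdivrMr// ltr_pMr// ltr1n.
move=> x y xv yv i j; rewrite distrC; apply: (H (x, y) _ (i, j)) => //.
by split; exact: B.
Qed.

Variables (v : 'rV[R]_m) (rho : R).

Definition clip x : 'rV[R]_m :=
  \row_i Num.max (v 0 i - rho) (Num.min (v 0 i + rho) (x 0 i)).

Hypothesis rho0 : 0 < rho.

Lemma clip_near x : `|clip x - v| <= rho.
Proof.
apply/rV_norm_le => [|i]; first exact: ltW.
rewrite !mxE ler_distl le_max lexx/= ge_max ge_min lexx/= andbT.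
by move: rho0; lra.
Qed.

Lemma clip_lip x y i : `|(clip x - clip y) 0 i| <= `|(x - y) 0 i|.
Proof.
rewrite !mxE; move: (v 0 i) (x 0 i) (y 0 i) => b s t.
have := ler_norm (s - t); have := ler_norm (t - s); rewrite (distrC t s).
move: (`|s - t|) => D ? ?; rewrite ler_norml /Num.max /Num.min.
by case: (ltP (b + rho) s) => ?; case: (ltP (b + rho) t) => ?;
  do ![case: ifPn; rewrite -?leNgt => ?]; apply/andP; split; lra.
Qed.

Lemma clip_id x : `|x - v| <= rho -> clip x = x.
Proof.
move=> /(rV_norm_le _ (ltW rho0)) H; apply/rowP => i; have := H i; rewrite !mxE.
rewrite ler_distl => /andP[h1 h2].
by rewrite (min_idPr h2) (max_idPr h1).
Qed.

Variable th : {set 'I_m}.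

Let L := secant v v.

Definition linpart w : 'rV[R]_m :=
  \row_i (if i \in th then \sum_j L i j * w 0 j else 0).

(* Only the nonlinear remainder is composed with [clip]: the estimate
   [cutoff_diff] is then global. *)
Definition cutoff x : 'rV[R]_m := linpart (x - v) +
  \row_i (if i \in th then vf (clip x) 0 i - \sum_j L i j * (clip x - v) 0 j else 0).

Variable a : R.
Hypothesis a0 : 0 <= a.
Hypothesis near_L : forall x y, `|x - v| <= rho -> `|y - v| <= rho ->
  forall i j, `|secant x y i j - L i j| <= a.

Lemma linpartE w i :
  linpart w 0 i = if i \in th then \sum_j L i j * w 0 j else 0.
Proof. by rewrite mxE. Qed.

Lemma cutoffE x i : cutoff x 0 i = if i \in th then \sum_j L i j * (x - v) 0 j +
  (vf (clip x) 0 i - \sum_j L i j * (clip x - v) 0 j) else 0.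
Proof. by rewrite mxE linpartE mxE; case: ifP => // _; rewrite addr0. Qed.

Lemma cutoff_supported x : supported th (cutoff x).
Proof. by move=> i ith; rewrite cutoffE (negbTE ith). Qed.

Lemma cutoff_diff x y i :
  `|(cutoff x - cutoff y - linpart (x - y)) 0 i| <= m%:R * a * `|x - y|.
Proof.
have B (s t : 'rV[R]_m) : (s - t) 0 i = s 0 i - t 0 i by rewrite !mxE.
rewrite 2!B !cutoffE linpartE; case: ifPn => ith; last first.
  by rewrite !subr0 normr0 !mulr_ge0.
have -> : \sum_j L i j * (x - v) 0 j +
    (vf (clip x) 0 i - \sum_j L i j * (clip x - v) 0 j) -
   (\sum_j L i j * (y - v) 0 j + (vf (clip y) 0 i - \sum_j L i j * (clip y - v) 0 j)) -
   \sum_j L i j * (x - y) 0 j =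
   \sum_j (secant (clip x) (clip y) i j - L i j) * (clip x - clip y) 0 j.
  under [RHS]eq_bigr do rewrite mulrBl.
  rewrite sumrB -secantP.
  have E (z1 z2 : 'rV[R]_m) : \sum_j L i j * (z1 - z2) 0 j =
      \sum_j L i j * z1 0 j - \sum_j L i j * z2 0 j.
    by rewrite -sumrB; apply: eq_bigr => j _; rewrite !mxE -mulrBr.
  rewrite !E; ring.
apply: le_trans (ler_norm_sum _ _ _) _.
rewrite -mulrA; apply: sum_ord_le => j; rewrite normrM; apply: ler_pM => //.
  by apply: near_L; exact: clip_near.
apply: le_trans (clip_lip _ _ _) _.
by have /rV_norm_le := lexx `|x - y|; apply.
Qed.

Lemma cutoff_lip : exists2 K, 0 < K & forall x y, `|cutoff x - cutoff y| <= K * `|x - y|.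
Proof.
pose S := \sum_i \sum_j `|L i j|.
have S0 : 0 <= S by apply: sumr_ge0 => i _; apply: sumr_ge0.
exists (m%:R * a + m%:R * S + 1) => [|x y].
  by rewrite ltr_wpDl// addr_ge0// mulr_ge0.
apply/rV_norm_le => [|i].
  by rewrite mulr_ge0// addr_ge0// addr_ge0// mulr_ge0.
have -> : (cutoff x - cutoff y) 0 i = (cutoff x - cutoff y - linpart (x - y)) 0 i +
   linpart (x - y) 0 i by rewrite [in RHS]mxE [X in _ + X + _]mxE subrK.
apply: le_trans (ler_normD _ _) _.
have Ll : `|linpart (x - y) 0 i| <= m%:R * S * `|x - y|.
  rewrite linpartE; case: ifPn => ith; last by rewrite normr0 !mulr_ge0.
  apply: le_trans (ler_norm_sum _ _ _) _.
  rewrite -mulrA; apply: sum_ord_le => j; rewrite normrM; apply: ler_pM => //.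
    rewrite /S (bigD1 i)//= (bigD1 j)//= -addrA lerDl addr_ge0//.
      by apply: sumr_ge0.
    by apply: sumr_ge0 => ? _; apply: sumr_ge0.
  by have /rV_norm_le := lexx `|x - y|; apply.
apply: le_trans (lerD (cutoff_diff x y i) Ll) _.
by rewrite -mulrDl ler_wpM2r// lerDl.
Qed.

Lemma cutoff_vf x i : `|x - v| <= rho -> i \in th -> cutoff x 0 i = vf x 0 i.
Proof.
move=> xv ith; rewrite cutoffE ith clip_id//; ring.
Qed.

Lemma cutoff_eq0 : (forall i, i \in th -> vf v 0 i = 0) -> cutoff v = 0.
Proof.
move=> H; apply/rowP => i; have [ith|ith] := boolP (i \in th).
  by rewrite cutoff_vf ?H ?mxE// subrr normr0 ltW.
by rewrite cutoff_supported ?mxE.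
Qed.

End System.

Lemma dot_cauchy_schwarz (R : realType) (m : nat) (c : 'I_m -> R) (x y : 'rV[R]_m) :
  (forall i, 0 <= c i) -> 0 < dot c x x -> dot c x y ^+ 2 <= dot c x x * dot c y y.
Proof.
move=> c0 x0; pose z := dot c x x *: y - dot c x y *: x.
have : 0 <= dot c z z.
  by apply: sumr_ge0 => i _; rewrite -mulrA -expr2 mulr_ge0 ?sqr_ge0.
have -> : dot c z z = dot c x x * (dot c x x * dot c y y - dot c x y ^+ 2).
  by rewrite /z !dotE (dotC c y x); ring.
by rewrite pmulr_rge0// subr_ge0.
Qed.

Section Saddle.
Variables (R : realType) (m : nat) (c P Q : 'I_m -> R) (v : 'rV[R]_m).
Variable th : {set 'I_m}.
Hypothesis c1 : forall i, 1 <= c i.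
Hypothesis Q0 : forall i, 0 <= Q i.
Hypothesis Qc : forall i, Q i <= c i.
Hypothesis vth : forall i, i \in th -> 0 < v 0 i.
Hypothesis eqv : forall i, i \in th -> quad c v + Q i * v 0 i ^+ 2 = 2 * P i * v 0 i.
Hypothesis vsupp : supported th v.
Hypothesis th2 : (1 < #|th|)%N.

Let dg i := quad c v - Q i * v 0 i ^+ 2.

Let c0 i : 0 < c i. Proof. exact: lt_le_trans ltr01 (c1 i). Qed.

Let term_ge0 (x : 'rV[R]_m) i : 0 <= c i * x 0 i * x 0 i.
Proof. by rewrite -mulrA -expr2 mulr_ge0 ?sqr_ge0// ltW. Qed.

Let quad_gt0 : 0 < quad c v.
Proof.
have /card_gt0P[i ith] : (0 < #|th|)%N by exact: ltn_trans th2.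
rewrite /quad /dot (bigD1 i)//= ltr_pwDl ?sumr_ge0//.
by rewrite !mulr_gt0 ?vth.
Qed.

Let dg_gt0 i : 0 < dg i.
Proof.
have [ith|ith] := boolP (i \in th); last first.
  by rewrite /dg vsupp// expr0n mulr0 subr0.
have /card_gt0P[j] : (0 < #|th :\ i|)%N.
  by move: th2; rewrite (cardsD1 i) ith add1n ltnS.
rewrite !inE => /andP[ji jth].
rewrite /dg /quad /dot (bigD1 i)//= (bigD1 j)//=.
have : 0 < c j * v 0 j * v 0 j by rewrite !mulr_gt0 ?vth.
have : 0 <= \sum_(k | (k != i) && (k != j)) c k * v 0 k * v 0 k by exact: sumr_ge0.
have : Q i * v 0 i ^+ 2 <= c i * v 0 i * v 0 i.
  by rewrite -mulrA -expr2 ler_wpM2r ?sqr_ge0.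
lra.
Qed.

Lemma linpart_saddle (w : 'rV[R]_m) i : supported th w ->
  linpart c P Q v th w 0 i = - dg i * w 0 i + 2 * v 0 i * dot c v w.
Proof.
move=> sw; rewrite linpartE; case: ifPn => ith; last first.
  by rewrite sw// vsupp// !mulr0 mul0r addr0.
rewrite /secant; under eq_bigr do rewrite mulrDl.
rewrite big_split/= (bigD1 i)//= eqxx mul1r big1 ?addr0 => [|j ji]; last first.
  by rewrite eq_sym (negbTE ji) !mul0r.
congr (_ + _).
  by congr (_ * _); have := eqv ith; rewrite /dg; lra.
by rewrite /dot mulr_sumr; apply: eq_bigr => j _; ring.
Qed.

(* [secular l = 1] is the characteristic equation of the linear part, and [e_ l]
   below the eigenvector. *)
Let secular (l : R) : R := \sum_i 2 * (c i * v 0 i * v 0 i) / (l + dg i).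

Let secular_root : exists2 l : R, 0 < l & secular l = 1.
Proof.
pose M := 2 * quad c v.
have M0 : 0 < M by rewrite mulr_gt0.
have s0 : 1 < secular 0.
  apply: (@lt_le_trans _ _ 2); first by rewrite ltr1n.
  have -> : 2 = \sum_i 2 * (c i * v 0 i * v 0 i) / quad c v :> R.
    by rewrite -mulr_suml -mulr_sumr mulfK// gt_eqF.
  apply: ler_sum => i _; rewrite add0r; apply: ler_wpM2l; first by rewrite mulr_ge0.
  rewrite lef_pV2 ?posrE//.
  by rewrite /dg gerBl mulr_ge0 ?sqr_ge0.
have sM : secular M <= 1.
  have -> : 1 = \sum_i 2 * (c i * v 0 i * v 0 i) / M :> R.
    by rewrite -mulr_suml -mulr_sumr mulfV// gt_eqF.
  apply: ler_sum => i _; apply: ler_wpM2l; first by rewrite mulr_ge0.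
  rewrite lef_pV2 ?posrE//; last exact: addr_gt0.
  by rewrite lerDl ltW.
have cs : {within `[0, M], continuous secular}.
  apply: (@cts_pos_itv _ _ secular) => //; apply: cts_pos_sum => i _.
  apply: cts_posM; first exact: cts_pos_cst.
  apply: cts_posV => [|l l0]; last by rewrite gt_eqF// ltr_wpDl.
  by apply: cts_posD; [apply: continuous_subspaceT => ?; exact: cvg_id|exact: cts_pos_cst].
have [|l] := IVT (ltW M0) cs (v := 1).
  by rewrite ge_min le_max sM (ltW s0) orbT.
rewrite in_itv/= => /andP[l0 _] l1; exists l => //.
rewrite lt_def l0 andbT; apply/eqP => lE.
by move: s0; rewrite -l1 lE ltxx.
Qed.

Let e_ l : 'rV[R]_m := \row_i (v 0 i / (l + dg i)).

Lemma saddle : exists (e : 'rV[R]_m) (k : R),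
  [/\ 0 < k, supported th e, dot c e e = 1, forall i, i \in th -> 0 < e 0 i &
   forall w, supported th w ->
     k * dot c e w ^+ 2 <= dot c e w * dot c e (linpart c P Q v th w) /\
     dot c w (linpart c P Q v th w) - dot c e w * dot c e (linpart c P Q v th w)
       <= - k * (dot c w w - dot c e w ^+ 2)].
Proof.
have [l l0 lE] := secular_root.
pose f := e_ l; pose D := dot (fun i => c i * dg i).
have lg i : l + dg i != 0 by rewrite gt_eqF// addr_gt0.
have f0 i : i \in th -> 0 < f 0 i by move=> ith; rewrite mxE divr_gt0 ?vth// addr_gt0.
have sf : supported th f by move=> i ith; rewrite mxE vsupp// mul0r.
have fE i : v 0 i = f 0 i * (l + dg i) by rewrite mxE divfK.
have vE (w : 'rV[R]_m) : dot c v w = l * dot c f w + D f w.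
  rewrite /D /dot mulr_sumr -big_split/=; apply: eq_bigr => i _.
  rewrite (fE i); move: (f 0 i) (dg i) (w 0 i) (c i) => s t x y; ring.
have vf2 : 2 * dot c v f = 1.
  rewrite -[RHS]lE /secular mulr_sumr; apply: eq_bigr => i _.
  by rewrite mxE !mulrA.
have /card_gt0P[i0 i0th] : (0 < #|th|)%N by exact: ltn_trans th2.
have N0 : 0 < dot c f f.
  by rewrite /dot (bigD1 i0)//= ltr_pwDl ?sumr_ge0// !mulr_gt0 ?f0.
have D_ge0 w : 0 <= D w w.
  by apply: sumr_ge0 => i _; rewrite -mulrA -expr2 mulr_ge0 ?sqr_ge0// ltW// mulr_gt0.
have D0 : 0 < D f f.
  rewrite /D /dot (bigD1 i0)//= ltr_pwDl ?sumr_ge0 ?mulr_gt0 ?f0// => i _.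
  by rewrite -mulrA -expr2 mulr_ge0 ?sqr_ge0// ltW// mulr_gt0.
have [mu mu0 /(_ _ isT) muE] := finite_lower_bound (A := predT) (fun i _ => dg_gt0 i).
have mu_le w : mu * dot c w w <= D w w.
  rewrite /D /dot mulr_sumr; apply: ler_sum => i _.
  have -> : mu * (c i * w 0 i * w 0 i) = mu * (c i * w 0 i ^+ 2) by ring.
  have -> : c i * dg i * w 0 i * w 0 i = dg i * (c i * w 0 i ^+ 2) by ring.
  by rewrite ler_wpM2r// mulr_ge0 ?sqr_ge0// ltW.
set N := dot c f f in N0 *.
have dotL x w : supported th w ->
    dot c x (linpart c P Q v th w) = 2 * dot c v x * dot c v w - D x w.
  move=> sw; rewrite /D /dot mulrAC mulr_sumr -sumrB; apply: eq_bigr => i _.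
  by rewrite linpart_saddle// -/(dot c v w); ring.
have NE : 2 * D f f = 1 - 2 * l * N by have := vE f; rewrite -/N; lra.
exists ((Num.sqrt N)^-1 *: f), (Num.min l (2 * l * N * mu)).
have sN : 0 < Num.sqrt N by rewrite sqrtr_gt0.
have sN2 : Num.sqrt N ^+ 2 = N by rewrite sqr_sqrtr// ltW.
split.
- by rewrite lt_min l0 !mulr_gt0.
- by move=> i ith; rewrite mxE sf// mulr0.
- by rewrite !dotE -/N mulrA -invfM -expr2 sN2 mulVf// gt_eqF.
- by move=> i ith; rewrite mxE mulr_gt0 ?invr_gt0// f0.
move=> w sw; rewrite !dotE.
have -> : dot c f (linpart c P Q v th w) = l * dot c f w.
  by rewrite dotL// vf2 mul1r vE addrK.
set b := dot c f w.
have aE : ((Num.sqrt N)^-1 * b) ^+ 2 = b ^+ 2 / N.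
  by rewrite exprMn exprVn sN2 mulrC.
have -> : (Num.sqrt N)^-1 * b * ((Num.sqrt N)^-1 * (l * b)) = l * (b ^+ 2 / N).
  by rewrite -aE; ring.
rewrite aE; have bN : 0 <= b ^+ 2 / N by rewrite divr_ge0 ?sqr_ge0// ltW.
split; first by rewrite ler_wpM2r// ge_min lexx.
pose t := b / N; have [s sE] : exists s, s = w - t *: f by eexists.
have fs : dot c f s = 0.
  by rewrite sE !dotE -/N -/b /t divfK ?subrr// gt_eqF.
have wE : w = s + t *: f by rewrite sE subrK.
have vs : dot c v s = D f s by rewrite vE fs mulr0 add0r.
have ss : dot c s s = dot c w w - b ^+ 2 / N.
  by rewrite sE !dotE (dotC c w f) -/N -/b /t; field; rewrite gt_eqF.
have tN : t ^+ 2 * N = b ^+ 2 / N by rewrite /t; field; rewrite gt_eqF.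
have wL : dot c w (linpart c P Q v th w) - l * (b ^+ 2 / N) =
    2 * D f s ^+ 2 - D s s.
  have vw : dot c v w = D f s + t / 2.
    have vf : dot c v f = 1 / 2 by move: vf2; lra.
    by rewrite wE !dotE vs vf mulrA mulr1.
  have Dw : D w w = D s s + 2 * t * D f s + t ^+ 2 * D f f.
    by rewrite [in LHS]wE /D !dotE (dotC _ s f); ring.
  rewrite dotL// vw Dw -tN.
  have -> : t ^+ 2 * D f f = t ^+ 2 * (1 - 2 * l * N) / 2.
    by rewrite -NE; field.
  by field.
rewrite wL -ss.
have CS : 2 * D f s ^+ 2 <= (1 - 2 * l * N) * D s s.
  rewrite -NE -mulrA ler_wpM2l//; apply: dot_cauchy_schwarz => // i.
  by rewrite mulr_ge0// ltW.
have : Num.min l (2 * l * N * mu) * dot c s s <= 2 * l * N * D s s.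
  apply: (@le_trans _ _ (2 * l * N * mu * dot c s s)).
    by rewrite ler_wpM2r ?dot_ge0// ge_min lexx orbT.
  by rewrite -mulrA ler_wpM2l// !mulr_ge0// ltW.
lra.
Qed.

End Saddle.

Lemma dot_norm_le (R : realType) (m : nat) (c : 'I_m -> R) (x y : 'rV[R]_m) :
  (forall i, 0 <= c i) -> `|dot c x y| <= (\sum_i c i) * `|x| * `|y|.
Proof.
move=> c0; apply: le_trans (ler_norm_sum _ _ _) _.
rewrite -mulrA mulr_suml; apply: ler_sum => i _.
rewrite !normrM (ger0_norm (c0 i)) -mulrA ler_wpM2l// ler_pM//.
  by have /rV_norm_le := lexx `|x|; apply.
by have /rV_norm_le := lexx `|y|; apply.
Qed.

Lemma continuous_addl (R : realType) (m : nat) (T : topologicalType)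
    (f : T -> 'rV[R]_m) (b : 'rV[R]_m) :
  continuous f -> continuous (fun t => b + f t).
Proof. by move=> cf t; apply: cvgD; [exact: cvg_cst|exact: cf]. Qed.

Lemma continuous_dot_div (R : realType) (m : nat) (c : 'I_m -> R) (T : topologicalType)
    (f : T -> 'rV[R]_m) (e : 'rV[R]_m) (a : R) :
  continuous f -> continuous (fun t => - (dot c e (f t) / a)).
Proof.
move=> cf t; apply: cvgN; apply: cvgM; last exact: cvg_cst.
by apply: (dot_continuous (c := c) _ cf); exact: cst_continuous.
Qed.

Lemma continuous_mulmx (R : realType) (d m : nat) (T : topologicalType)
    (f : T -> 'rV[R]_d) (B : 'M[R]_(d, m)) :
  continuous f -> continuous (fun t => f t *m B).
Proof.
move=> cf t; apply: cvg_rV => i; move: t; rewrite -/(continuous _).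
have -> : (fun t => (f t *m B) 0 i) = \sum_k (fun t => f t 0 k * B k i).
  by apply/funext => t; rewrite mxE fct_sumE.
apply: (big_ind (fun h : T -> R => continuous h)) => [|h1 h2 c1 c2 t|k _ t].
- exact: cst_continuous.
- by apply: cvgD; [exact: c1|exact: c2].
- apply: cvgM; last exact: cvg_cst.
  exact: (cvg_comp f (fun y => y 0 k) (cf t) (@coord_continuous _ _ _ 0 k (f t))).
Qed.

Lemma continuous_radial (R : realType) (m : nat) (c : 'I_m -> R) (T : topologicalType)
    (f : T -> 'rV[R]_m) (r : R) :
  continuous f -> (forall t, 1 <= dot c (f t) (f t)) ->
  continuous (fun t => (r / Num.sqrt (dot c (f t) (f t))) *: f t).
Proof.
move=> cf f1 t; apply: cvgZ; last exact: cf.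
apply: cvgM; first exact: cvg_cst.
apply: cvgV; first by rewrite gt_eqF// sqrtr_gt0 (lt_le_trans ltr01).
apply: (cvg_comp (fun t => dot c (f t) (f t)) Num.sqrt).
  exact: (dot_continuous (c := c) cf cf (x := t)).
exact: sqrt_continuous.
Qed.

(** * Convergent families *)

Section Sphere.
Variables (R : realType) (m : nat) (c : 'I_m -> R) (th : {set 'I_m}) (e : 'rV[R]_m).
Hypothesis c1 : forall i, 1 <= c i.
Hypothesis e_gt0 : forall i, i \in th -> 0 < e 0 i.
Hypothesis th2 : (2 <= #|th|)%N.
Variable r : R.
Hypothesis r0 : 0 < r.

(* A chart of an open hemisphere of the sphere of radius [r] in the orthogonal
   complement of [e]: radial projection of an affine hyperplane. *)
Lemma hemisphere_chart : exists sigma : 'rV[R]_(#|th| - 2) -> 'rV[R]_m,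
  [/\ continuous sigma, injective sigma, forall s, supported th (sigma s),
      forall s, dot c e (sigma s) = 0 & forall s, dot c (sigma s) (sigma s) = r ^+ 2].
Proof.
have /card_gt0P[i0 i0th] : (0 < #|th|)%N by exact: leq_trans th2.
have /card_gt0P[i1] : (0 < #|th :\ i0|)%N.
  by move: th2; rewrite (cardsD1 i0) i0th add1n ltnS.
rewrite !inE => /andP[i10 i1th].
pose A := th :\ i0 :\ i1.
have dA : (#|th| - 2)%N = #|A|.
  rewrite (cardsD1 i0) i0th (cardsD1 i1 (th :\ i0)) !inE i10 i1th/=.
  by rewrite !add1n !subSS subn0.
set d := (#|th| - 2)%N in dA *.
pose iota (k : 'I_d) : 'I_m := enum_val (cast_ord dA k).
have iotaA k : iota k \in A by exact: enum_valP.
have iota_inj : injective iota by move=> k l /enum_val_inj/cast_ord_inj.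
have iota1 k : iota k != i1 by have := iotaA k; rewrite !inE => /and3P[].
have iota0 k : iota k != i0 by have := iotaA k; rewrite !inE => /and3P[].
have iotath k : iota k \in th by have := iotaA k; rewrite !inE => /and3P[].
pose B : 'M[R]_(d, m) := \matrix_(k, j) (iota k == j)%:R.
pose h0 (s : 'rV[R]_d) : 'rV[R]_m := delta_mx 0 i1 + s *m B.
pose h s := h0 s + (- (dot c e (h0 s) / (c i0 * e 0 i0))) *: delta_mx 0 i0.
have ce0 : 0 < c i0 * e 0 i0 by rewrite mulr_gt0 ?e_gt0// (lt_le_trans ltr01).
have dot_delta x : dot c x (delta_mx 0 i0) = c i0 * x 0 i0.
  rewrite /dot (bigD1 i0)//= big1 ?addr0 => [|j j0]; rewrite mxE eqxx.
    by rewrite eqxx mulr1.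
  by rewrite (negbTE j0) mulr0.
have he s : dot c e (h s) = 0.
  by rewrite /h dotDr dotZr dot_delta mulNr divfK ?subrr// gt_eqF.
have h1 s : h s 0 i1 = 1.
  rewrite !mxE !eqxx (negbTE i10) mulr0 addr0 big1 ?addr0// => k _.
  by rewrite mxE (negbTE (iota1 k)) mulr0.
have hk s k : h s 0 (iota k) = s 0 k.
  rewrite !mxE eqxx (negbTE (iota0 k)) (negbTE (iota1 k)) mulr0 addr0 add0r.
  rewrite (bigD1 k)//= mxE eqxx mulr1 big1 ?addr0// => l lk.
  by rewrite mxE (inj_eq iota_inj) (negbTE lk) mulr0.
have hth s : supported th (h s).
  move=> i ith; rewrite !mxE eqxx.
  have /negbTE -> : i != i1 by apply: contraNneq ith => ->.
  have /negbTE -> : i != i0 by apply: contraNneq ith => ->.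
  rewrite mulr0 addr0 add0r big1// => k _; rewrite mxE.
  have /negbTE -> : iota k != i by apply: contraNneq ith => <-.
  by rewrite mulr0.
have hn s : 1 <= dot c (h s) (h s).
  by apply: le_trans (coord_le_dot c1 (h s) i1); rewrite h1 expr1n.
have cB : continuous (fun s : 'rV[R]_d => s *m B).
  by apply: (@continuous_mulmx R d m _ id B) => s; exact: cvg_id.
have ch0 : continuous h0 := continuous_addl (b := delta_mx 0 i1) cB.
have ch : continuous h.
  exact: (continuous_affine (v := delta_mx 0 i1) (e := delta_mx 0 i0) cB
    (continuous_dot_div (c := c) (e := e) (a := c i0 * e 0 i0) ch0)).
pose N s := Num.sqrt (dot c (h s) (h s)).
have N0 s : 0 < N s by rewrite sqrtr_gt0 (lt_le_trans ltr01).
exists (fun s => (r / N s) *: h s); split.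
- exact: continuous_radial.
- move=> s t /rowP E.
  have Z a (x : 'rV[R]_m) j : (a *: x) 0 j = a * x 0 j by rewrite mxE.
  have NE : r / N s = r / N t by have := E i1; rewrite !Z !h1 !mulr1.
  apply/rowP => k; have := E (iota k); rewrite !Z -NE !hk.
  by apply: mulfI; rewrite mulf_neq0 ?invr_eq0 ?gt_eqF.
- by move=> s; apply: supportedZ.
- by move=> s; rewrite dotZr he mulr0.
- move=> s; rewrite dotZr dotZl mulrA -expr2 expr_div_n sqr_sqrtr ?divfK//.
    by rewrite gt_eqF// (lt_le_trans ltr01).
  exact: le_trans (hn s).
Qed.

End Sphere.

Section LocalFamily.
Variables (R : realType) (m : nat) (c P Q : 'I_m -> R) (v : 'rV[R]_m).
Variable th : {set 'I_m}.
Hypothesis c1 : forall i, 1 <= c i.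
Hypothesis Q0 : forall i, 0 <= Q i.
Hypothesis Qc : forall i, Q i <= c i.
Hypothesis vth : forall i, i \in th -> 0 < v 0 i.
Hypothesis eqv : forall i, i \in th -> quad c v + Q i * v 0 i ^+ 2 = 2 * P i * v 0 i.
Hypothesis vsupp : supported th v.
Hypothesis th2 : (2 <= #|th|)%N.

Theorem convergent_family :
  exists Phi : 'rV[R]_(#|th| - 2) -> R -> 'rV[R]_m,
  [/\ {within setT `*` `[0, +oo[, continuous (fun z => Phi z.1 z.2)},
      forall s, flow_of (vf c P Q) (Phi s) /\
        ~ (forall u : R, 0 <= u -> Phi s u = Phi s 0),
      forall s s', same_flow_line (Phi s) (Phi s') -> s = s',
      forall s (u : R), 0 <= u -> supported th (Phi s u) /\
        forall i, i \in th -> 0 < Phi s u 0 i &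
      forall s, Phi s u @[u --> +oo] --> v].
Proof.
have [e [k [k0 eth e1 e_gt0 saddleP]]] := saddle c1 Q0 Qc vth eqv vsupp th2.
have c0 i : 0 <= c i by exact: le_trans ler01 (c1 i).
pose C := \sum_i c i.
have C0 : 0 <= C by exact: sumr_ge0.
pose a := k / 8 / (C * m%:R + 1).
have Cm0 : 0 < C * m%:R + 1 by rewrite ltr_wpDl// mulr_ge0.
have a0 : 0 < a by rewrite !divr_gt0.
have Ca : C * (m%:R * a) <= k / 8.
  rewrite mulrA /a mulrCA -[leRHS]mulr1; apply: ler_wpM2l.
    by rewrite divr_ge0// ltW.
  by rewrite ler_pdivrMr// mul1r lerDl.
have [rho1 rho10 near1] := secant_near c P Q v a0.
have [d d0 dP] := finite_lower_bound vth.
pose rho := Num.min rho1 (d / 2).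
have rho0 : 0 < rho by rewrite lt_min rho10 divr_gt0.
have rho_d : rho < d.
  by rewrite gt_min; apply/orP; right; rewrite ltr_pdivrMr// ltr_pMr// ltr1n.
have near_L x y : `|x - v| <= rho -> `|y - v| <= rho ->
    forall i j, `|secant c P Q x y i j - secant c P Q v v i j| <= a.
  by rewrite !le_min => /andP[xv _] /andP[yv _]; exact: near1.
pose G := cutoff c P Q v rho th.
pose L := linpart c P Q v th.
have Gth x : supported th (G x) by exact: cutoff_supported.
have [K K0 LG] := cutoff_lip rho0 th (ltW a0) near_L.
have vfv i : i \in th -> vf c P Q v 0 i = 0.
  by move=> ith; rewrite mxE eqv// subrr mulr0.
have Gv : G v = 0 by exact: cutoff_eq0.
pose eta x y := G x - G y - L (x - y).
have etaP x y : `|eta x y| <= m%:R * a * `|x - y|.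
  apply/rV_norm_le => [|i]; first by rewrite mulr_ge0// mulr_ge0// ltW.
  exact: (cutoff_diff rho0 th (ltW a0) near_L).
have W0 x : 0 <= dot c x x by exact: dot_ge0.
have norm_sqrt x : `|x| <= Num.sqrt (dot c x x).
  apply: (norm_le_dot c1); first exact: sqrtr_ge0.
  by rewrite sqr_sqrtr.
have normW x : `|x| ^+ 2 <= dot c x x.
  by rewrite -[leRHS]sqr_sqrtr// ler_sqr ?nnegrE ?sqrtr_ge0.
have dot_w_eta x y : `|dot c (x - y) (eta x y)| <= k / 8 * dot c (x - y) (x - y).
  apply: le_trans (dot_norm_le _ _ c0) _.
  apply: (@le_trans _ _ (C * `|x - y| * (m%:R * a * `|x - y|))).
    by apply: ler_wpM2l => //; rewrite mulr_ge0.
  have -> : C * `|x - y| * (m%:R * a * `|x - y|) = C * (m%:R * a) * `|x - y| ^+ 2.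
    by ring.
  by apply: ler_pM => //; rewrite ?sqr_ge0// mulr_ge0// mulr_ge0// ltW.
have dot_e_eta x y : `|dot c e (x - y) * dot c e (eta x y)| <=
    k / 8 * dot c (x - y) (x - y).
  rewrite normrM -[X in _ <= _ * X]sqr_sqrtr// expr2 mulrCA.
  apply: ler_pM => //.
    by rewrite -sqrtr_sqr ler_sqrt// sqr_dot_le.
  apply: le_trans (dot_norm_le _ _ c0) _.
  have e_le1 : `|e| <= 1 by apply: (norm_le_dot c1) => //; rewrite e1 expr1n.
  apply: (@le_trans _ _ (C * 1 * (m%:R * a * `|x - y|))).
    by apply: ler_pM => //; [rewrite mulr_ge0|apply: ler_wpM2l].
  rewrite mulr1 mulrA; apply: ler_pM => //.
  by rewrite mulr_ge0// mulr_ge0// ltW.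
have GE x y : G x - G y = L (x - y) + eta x y by rewrite /eta [RHS]addrC subrK.
have expand x y : supported th (x - y) ->
    2 * k * dot c e (x - y) ^+ 2 - k / 2 * dot c (x - y) (x - y) <=
    2 * dot c e (x - y) * dot c e (G x - G y).
  move=> sxy; have [h _] := saddleP _ sxy.
  rewrite GE (dotDr _ _ (L _)) mulrDr -!mulrA.
  have := dot_e_eta x y; rewrite ler_norml => /andP[h1 _].
  have : 0 <= k * dot c (x - y) (x - y) by rewrite mulr_ge0// ltW.
  move: h h1; rewrite /L; lra.
have contract x y : supported th (x - y) ->
    2 * dot c (x - y) (G x - G y) - 2 * dot c e (x - y) * dot c e (G x - G y) <=
    - (2 * k) * (dot c (x - y) (x - y) - dot c e (x - y) ^+ 2) +
    k / 2 * dot c (x - y) (x - y).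
  move=> sxy; have [_ h] := saddleP _ sxy.
  rewrite GE !(dotDr _ _ (L _)) !mulrDr -!mulrA.
  have := dot_e_eta x y; rewrite ler_norml => /andP[h1 _].
  have := dot_w_eta x y; rewrite ler_norml => /andP[_ h2].
  move: h h1 h2; rewrite /L; lra.
have r0 : 0 < rho / 2 by rewrite divr_gt0.
have [sigma [cs si ss so sn]] := hemisphere_chart c1 e_gt0 th2 r0.
have [Phi [cP fP dP' sP bP]] := stable_manifold_family c1 e1 k0 eth Gth expand contract
  K0 Gv LG cs si ss so r0 sn.
exists Phi.
have close s (u : R) : 0 <= u -> `|Phi s u - v| <= rho.
  move=> u0; apply: (norm_le_dot c1); first exact: ltW.
  apply: le_trans (bP s u u0) _.
  have : expR (- k * u) <= 1.
    by rewrite -expR0 ler_expR mulNr oppr_le0 mulr_ge0// ltW.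
  have : 0 < expR (- k * u) by exact: expR_gt0.
  have := exprn_gt0 2 rho0.
  rewrite expr_div_n; move: (rho ^+ 2) (expR _) => A B A0 B0 B1.
  have : A * B <= A * 1 by rewrite ler_pM2l.
  lra.
have supp s (u : R) : 0 <= u -> supported th (Phi s u).
  by move=> u0 i ith; have := sP s u u0 i ith; rewrite !mxE vsupp// subr0.
split=> //.
- move=> s; have [[cPs dPs] nst] := fP s; split => //; split=> // u u0 i.
  have [ith|ith] := boolP (i \in th).
    have := dPs u u0 i; rewrite cutoff_vf// close// ltW//.
  have := dPs u u0 i; rewrite (Gth _ _ ith).
  by rewrite [in X in _ -> X]mxE (supp s u (ltW u0) i ith) mul0r.
- move=> s u u0; split; first exact: supp.
  move=> i ith; have := close s u u0.
  move/(rV_norm_le _ (ltW rho0))/(_ i); rewrite !mxE ler_distl => /andP[+ _].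
  have := dP i ith; lra.
- move=> s; apply/cvgrPdist_le => x x0.
  have [M M0 HM] : exists2 M : R, 0 <= M & forall u, M <= u ->
      2 * (rho / 2) ^+ 2 * expR (- k * u) <= x ^+ 2.
    pose A := 2 * (rho / 2) ^+ 2; have A0 : 0 <= A by rewrite mulr_ge0// sqr_ge0.
    exists (A / (k * x ^+ 2)) => [|u Mu].
      by rewrite divr_ge0// mulr_ge0 ?sqr_ge0// ltW.
    rewrite mulNr expRN ler_pdivrMr ?expR_gt0// -/A.
    apply: le_trans (_ : x ^+ 2 * (1 + k * u) <= _); last first.
      by rewrite ler_wpM2l ?sqr_ge0// expR_ge1Dx.
    move: Mu; rewrite ler_pdivrMr ?mulr_gt0 ?exprn_gt0// => Mu.
    have := sqr_ge0 x; move: Mu; lra.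
  exists M; split; first exact: num_real.
  move=> u Mu; rewrite distrC; apply: (norm_le_dot c1); first exact: ltW.
  have u0 : 0 <= u by exact: le_trans M0 (ltW Mu).
  exact: le_trans (bP s u u0) (HM u (ltW Mu)).
Qed.

End LocalFamily.

(** * Ancient solutions *)

Section Ancient.
Variables (R : realType) (m : nat) (n p : 'I_m -> nat) (q : 'I_m -> int).
Variable Y : R -> 'rV[R]_m.
Hypothesis solY : solution_Y n p q Y.
Hypothesis posY : positive_Y Y.
Variable a0 : R.
Hypothesis a00 : 0 < a0.

Let e (u : R) := E n q (Y u).

Let e_cts : cts_pos e.
Proof.
case: solY => _ /cts_row cY _; apply: cts_pos_sum => i _.
by apply: cts_posM; [exact: cts_pos_cst|exact: cts_posX].
Qed.

Let e_ge0 u : 0 <= e u.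
Proof. by apply: sumr_ge0 => i _; rewrite mulr_ge0 ?sqr_ge0// mulr_ge0 ?sqr_ge0. Qed.

Let A := a_of n q Y a0.

Let A_gt0 u : 0 < A u. Proof. by rewrite /A /a_of mulr_gt0 ?expR_gt0. Qed.

Let A_cts : cts_pos A.
Proof.
apply: cts_posM; first exact: cts_pos_cst.
apply: (cts_pos_comp (h := @expR R)); first exact: continuous_expR.
exact: primitive_cts.
Qed.

Let A_derive (u : R) : 0 < u -> is_derive u 1 A (A u * e u).
Proof.
move=> u0; have d1 := is_derive1_comp (f := expR) (is_derive_expR _)
  (primitive_derive e_cts u0).
by apply: (is_derive_eq (is_deriveZ a0 d1)); rewrite /GRing.scale/= mulrA.
Qed.

Let T := tau_of n q Y a0.

Let T0 : T 0 = 0. Proof. exact: primitive0. Qed.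

Let T_cts : cts_pos T. Proof. exact: primitive_cts. Qed.

Let T_derive (u : R) : 0 < u -> is_derive u 1 T (A u).
Proof. exact: primitive_derive. Qed.

Let a0_le_A (u : R) : 0 <= u -> a0 <= A u.
Proof.
move=> u0; rewrite /A /a_of ler_pMr// -expR0 ler_expR -[leLHS](primitive0 e).
exact: (ndecr_pos (primitive_cts e_cts) (fun v => primitive_derive e_cts) (lexx 0) u0
  (fun v _ _ => e_ge0 v)).
Qed.

Let T_grows (u v : R) : 0 <= u -> u <= v -> a0 * (v - u) <= T v - T u.
Proof.
move=> u0 uv.
have D0 (w : R) : 0 < w -> is_derive w (1 : R) (fun x : R => a0 * x) a0.
  by move=> _; rewrite -[X in is_derive _ _ _ X]mulr1; exact: is_deriveZ.
have cD : cts_pos (fun x : R => a0 * x).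
  by apply: cts_posM; [exact: cts_pos_cst|apply: continuous_subspaceT => ?; exact: cvg_id].
have := ndecr_pos (cts_posB T_cts cD) (fun w w0 => is_deriveB (T_derive w0) (D0 w w0)) u0 uv.
rewrite mulrBr => H; suff : T u - a0 * u <= T v - a0 * v by lra.
apply: H => w uw _; rewrite subr_ge0 a0_le_A//.
by apply: ltW; exact: le_lt_trans uw.
Qed.

Let T_lt (u v : R) : 0 <= u -> u < v -> T u < T v.
Proof.
move=> u0 uv; rewrite -subr_gt0; apply: lt_le_trans (T_grows u0 (ltW uv)).
by rewrite mulr_gt0 ?subr_gt0.
Qed.

Let T_inj (u v : R) : 0 <= u -> 0 <= v -> T u = T v -> u = v.
Proof.
move=> u0 v0 E; case: (ltgtP u v) => // uv.
  by have := T_lt u0 uv; rewrite E ltxx.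
by have := T_lt v0 uv; rewrite E ltxx.
Qed.

Let T_onto (t : R) : 0 < t -> exists2 u : R, 0 < u & T u = t.
Proof.
move=> t0; have b0 : 0 <= t / a0 by rewrite divr_ge0 ?ltW.
have [|u] := IVT b0 (@cts_pos_itv _ _ _ _ (t / a0) T_cts (lexx 0)) (v := t).
  have := T_grows (lexx 0) b0; rewrite T0 !subr0 mulrC divfK ?gt_eqF// => tT.
  by rewrite ge_min le_max (ltW t0) tT orbT.
rewrite in_itv/= => /andP[u0 _] Tu; exists u => //.
rewrite lt_def u0 andbT; apply/eqP => u0'.
by move: t0; rewrite -Tu u0' T0 ltxx.
Qed.

Let Tinv (t : R) : R := xget 0 [set u | 0 <= u /\ T u = t].

Let TK (u : R) : 0 <= u -> Tinv (T u) = u.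
Proof.
move=> u0; have [v0 E] : [set v | 0 <= v /\ T v = T u] (Tinv (T u)).
  by apply: xgetPex; exists u.
exact: T_inj.
Qed.

Let time_derive (f h : R -> R) (dh u : R) : 0 < u ->
  (forall v : R, 0 <= v -> f (T v) = h v) -> is_derive u 1 h dh ->
  is_derive (T u) 1 f (dh / A u).
Proof.
move=> u0 fh hd.
have invD : is_derive (T u) 1 Tinv (A u)^-1.
  apply: is_derive_inverse; last by rewrite gt_eqF.
  - by near=> v; apply: TK; apply: ltW; near: v; exact: lt_nbhsr.
  - near=> v; apply: cts_pos_at => //; near: v; exact: lt_nbhsr.
  - exact: T_derive.
have hd' : is_derive (Tinv (T u)) 1 h dh by rewrite TK// ltW.
apply: near_eq_is_derive (is_derive1_comp hd' invD); near=> t.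
have t0 : 0 < t by near: t; apply: lt_nbhsr; rewrite -T0; exact: T_lt.
have [v v0 <-] := T_onto t0.
by rewrite /= TK ?fh// ltW.
Unshelve. all: by end_near. Qed.

Lemma exists_corresponding : exists a b, corresponds n q Y a0 a b.
Proof.
exists (fun t => A (Tinv t)), (fun t => \row_i (A (Tinv t) / Y (Tinv t) 0 i)) => u u0 tau.
rewrite TK//; split=> // [|i].
  by split=> // i; rewrite mxE divr_gt0// posY.
by rewrite mxE invf_div mulrCA divff ?mulr1// gt_eqF.
Qed.

Lemma corresponding_ancient a b :
  corresponds n q Y a0 a b -> ancient_solution n p q a b.
Proof.
move=> cab; exists 0 => t t0; have [u u0 <-] := T_onto t0.
have [met aE YE] := cab u (ltW u0).
have A0 := A_gt0 u.
split=> //.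
- apply: (is_derive_eq (time_derive u0 _ (A_derive u0))).
    by move=> v v0; have [] := cab v v0.
  rewrite mulrAC divff ?gt_eqF// mul1r /e /E; apply: eq_bigr => i _.
  by rewrite YE expr_div_n.
- move=> i; have Y0 : Y u 0 i != 0 by rewrite gt_eqF// posY// ltW.
  have [_ _ /(_ u u0 i) Yd] := solY.
  have qd := is_deriveM (A_derive u0) (is_deriveV Y0 Yd).
  apply: (is_derive_eq (time_derive u0 _ qd)).
    move=> v v0; have [[av bv] avE YvE] := cab v v0.
    rewrite /= -[RHS]/(A v * (Y v 0 i)^-1) YvE invf_div mulrCA avE divff ?mulr1//.
    by rewrite gt_eqF.
  rewrite -YE /GRing.scale/= -/(e u) /F -/(e u).
  by field; rewrite gt_eqF.
Qed.

End Ancient.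

Theorem positive_yields_ancient (R : realType) (m : nat) (n p : 'I_m -> nat)
    (q : 'I_m -> int) (Y : R -> 'rV[R]_m) :
  solution_Y n p q Y -> positive_Y Y -> yields_ancient_solution n p q Y.
Proof.
move=> sY pY a0 a00; split; first exact: (exists_corresponding sY).
by move=> a b; apply: corresponding_ancient.
Qed.

(** * Small solutions *)

Lemma sign_preserved (R : realType) (f df : R -> R) (K u : R) :
  cts_pos f -> (forall v : R, 0 < v -> is_derive v 1 f (df v)) ->
  (forall v : R, 0 < v -> `|df v| <= K * `|f v|) -> 0 <= f 0 -> 0 <= u -> 0 <= f u.
Proof.
move=> cf fd fK f0 u0; rewrite leNgt; apply/negP => fu.
have [|s] := IVT u0 (@cts_pos_itv _ _ _ _ u cf (lexx 0)) (v := 0).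
  by rewrite ge_min le_max f0 (ltW fu) orbT.
rewrite in_itv/= => /andP[s0 su] fs.
have dd (v : R) : 0 < v -> is_derive v 1 (fun v => - (f v ^+ 2 * expR (- (2 * K) * v)))
    (- (2 * f v * df v - 2 * K * f v ^+ 2) * expR (- (2 * K) * v)).
  move=> v0.
  apply: (is_derive_eq (is_deriveN (is_deriveM (is_derive_sqr (fd v v0))
    (is_derive_expRM _ _)))).
  by rewrite /GRing.scale/=; ring.
have cc : cts_pos (fun v => - (f v ^+ 2 * expR (- (2 * K) * v))).
  apply: (cts_pos_comp (@oppr_continuous _ _)).
  by apply: cts_posM; [exact: cts_posX|exact: expRM_cts_pos].
have := ndecr_pos cc dd s0 su.
rewrite fs expr0n/= mul0r oppr0 oppr_ge0 => H.
suff : f u ^+ 2 * expR (- (2 * K) * u) <= 0.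
  by apply/negP; rewrite -ltNge mulr_gt0 ?expR_gt0// exprn_even_gt0//= lt_eqF.
apply: H => v sv _; rewrite mulr_ge0 ?expR_ge0// oppr_ge0 subr_le0.
have v0 : 0 < v by exact: le_lt_trans sv.
apply: le_trans (ler_norm _) _; rewrite !normrM ger0_norm// -!mulrA ler_wpM2l//.
rewrite -(real_normK (num_real (f v))) expr2 mulrA mulrC ler_wpM2r//.
exact: fK.
Qed.

Section Small.
Variables (R : realType) (m : nat) (c P Q : 'I_m -> R).
Hypothesis m0 : (0 < m)%N.
Hypothesis c0 : forall i, 0 <= c i.
Hypothesis Q0 : forall i, 0 <= Q i.
Hypothesis P1 : forall i, 1 <= P i.

Let C := \sum_i c i + \sum_i Q i.

Let C0 : 0 <= C. Proof. by rewrite addr_ge0 ?sumr_ge0. Qed.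

Definition total (y : 'rV[R]_m) : R := \sum_i y 0 i.
Definition sqnorm (y : 'rV[R]_m) : R := \sum_i y 0 i ^+ 2.

Let nonneg (y : 'rV[R]_m) := forall i, 0 <= y 0 i.

Let sq0 y : 0 <= sqnorm y. Proof. by apply: sumr_ge0 => i _; exact: sqr_ge0. Qed.

Let coord_sq (y : 'rV[R]_m) i : y 0 i ^+ 2 <= sqnorm y.
Proof. by rewrite /sqnorm (bigD1 i)//= lerDl sumr_ge0// => j _; exact: sqr_ge0. Qed.

Let coord_total (y : 'rV[R]_m) i : nonneg y -> y 0 i <= total y.
Proof. by move=> y0; rewrite /total (bigD1 i)//= lerDl sumr_ge0. Qed.

Lemma total_vf_le (y : 'rV[R]_m) : nonneg y ->
  total (vf c P Q y) <= (C * total y - 2) * sqnorm y.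
Proof.
move=> y0; have -> : (C * total y - 2) * sqnorm y =
    \sum_i (y 0 i * (C * sqnorm y) - 2 * y 0 i ^+ 2).
  by rewrite sumrB -mulr_suml -mulr_sumr -/(total y) -/(sqnorm y); ring.
apply: ler_sum => i _; rewrite mxE.
have h1 : quad c y <= (\sum_i c i) * sqnorm y.
  rewrite /quad /dot mulr_suml; apply: ler_sum => j _.
  by rewrite -mulrA -expr2 ler_wpM2l.
have h2 : Q i * y 0 i ^+ 2 <= (\sum_i Q i) * sqnorm y.
  apply: ler_pM => //; first exact: sqr_ge0.
  by rewrite (bigD1 i)//= lerDl sumr_ge0.
have -> : y 0 i * (quad c y + Q i * y 0 i ^+ 2 - 2 * P i * y 0 i) =
  y 0 i * (quad c y + Q i * y 0 i ^+ 2) - 2 * (P i * y 0 i ^+ 2) by ring.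
apply: lerB.
  by rewrite ler_wpM2l// /C mulrDl lerD.
by rewrite ler_wpM2l// ler_peMl ?sqr_ge0.
Qed.

Let total_cts (Y : R -> 'rV[R]_m) : cts_pos Y -> cts_pos (fun u => total (Y u)).
Proof. by move=> /cts_row cY; apply: cts_pos_sum. Qed.

Let total_derive (G : 'rV[R]_m -> 'rV[R]_m) (Y : R -> 'rV[R]_m) (u : R) :
  flow_of G Y -> 0 < u ->
  is_derive u 1 (fun v => total (Y v)) (total (G (Y u))).
Proof.
move=> [_ dY] u0; have -> : (fun v => total (Y v)) = \sum_i (fun v => Y v 0 i).
  by apply/funext => v; rewrite fct_sumE.
by apply: is_derive_sum => i; exact: dY.
Qed.

Variable r : R.
Hypothesis r0 : 0 < r.
Hypothesis Cr : C * r <= 1.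

Section Decay.
Variable Y : R -> 'rV[R]_m.
Hypothesis fY : flow_of (vf c P Q) Y.
Hypothesis Y0 : forall u : R, 0 <= u -> nonneg (Y u).
Hypothesis Yr : total (Y 0) <= r.

Lemma small_stays (u : R) : 0 <= u -> total (Y u) <= r.
Proof.
move=> u0.
have ck : cts_pos (fun u => C * sqnorm (Y u)).
  apply: cts_posM; first exact: cts_pos_cst.
  case: fY => /cts_row cY _; apply: cts_pos_sum => i _; exact: cts_posX.
pose k := primitive (fun u => C * sqnorm (Y u)).
have ch : cts_pos (fun u => r - total (Y u)).
  by apply: cts_posB; [exact: cts_pos_cst|apply: total_cts; exact: fY.1].
have cek : cts_pos (fun u => expR (- k u)).
  apply: (cts_pos_comp (h := @expR R)); first exact: continuous_expR.
  exact: (cts_pos_comp (@oppr_continuous _ _) (primitive_cts ck)).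
have dd (v : R) : 0 < v -> is_derive v 1 (fun v => (r - total (Y v)) * expR (- k v))
   (expR (- k v) * (- total (vf c P Q (Y v)) - C * sqnorm (Y v) * (r - total (Y v)))).
  move=> v0.
  have d1 : is_derive v (1 : R) (fun v => r - total (Y v)) (0 - total (vf c P Q (Y v))).
    exact: is_deriveB (is_derive_cst _ _ _) (total_derive fY v0).
  have d2 := is_derive1_comp (f := expR) (is_derive_expR _)
    (is_deriveN (primitive_derive ck v0)).
  by apply: (is_derive_eq (is_deriveM d1 d2)); rewrite /GRing.scale/= /k; ring.
have := ndecr_pos (cts_posM ch cek) dd (lexx 0) u0.
have k0 : k 0 = 0 by exact: primitive0.
rewrite k0 oppr0 expR0 mulr1 => H.
have : 0 <= (r - total (Y u)) * expR (- k u).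
  apply: le_trans (H _) => [|v v0 _]; first by rewrite subr_ge0.
  rewrite mulr_ge0 ?expR_ge0// subr_ge0.
  have := total_vf_le (Y0 (ltW v0)); have := sq0 (Y v).
  have : C * r * sqnorm (Y v) <= 1 * sqnorm (Y v) by rewrite ler_wpM2r.
  lra.
by rewrite pmulr_lge0 ?expR_gt0// subr_ge0.
Qed.

Lemma small_tends_to0 : Y u @[u --> +oo] --> (0 : 'rV[R]_m).
Proof.
have m0' : 0 < m%:R :> R by rewrite ltr0n.
have dS (v : R) : 0 < v -> total (vf c P Q (Y v)) <= - sqnorm (Y v).
  move=> v0; apply: le_trans (total_vf_le (Y0 (ltW v0))) _.
  have : C * total (Y v) * sqnorm (Y v) <= C * r * sqnorm (Y v).
    by rewrite ler_wpM2r// ler_wpM2l// small_stays// ltW.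
  have : C * r * sqnorm (Y v) <= 1 * sqnorm (Y v) by rewrite ler_wpM2r.
  lra.
have cS := total_cts fY.1.
have noninc (a b : R) : 0 <= a -> a <= b -> total (Y b) <= total (Y a).
  move=> a0 ab; rewrite -lerN2.
  apply: (ndecr_pos (cts_pos_comp (@oppr_continuous _ _) cS)
    (fun v v0 => is_deriveN (total_derive fY v0)) a0 ab) => v av _.
  have v0 : 0 < v by exact: le_lt_trans av.
  by rewrite oppr_ge0 (le_trans (dS v v0))// oppr_le0.
apply/cvgrPdist_le => x x0.
exists (r * m%:R / x ^+ 2); split; first exact: num_real.
move=> u ru; have u0 : 0 < u.
  by apply: le_lt_trans ru; rewrite divr_ge0 ?sqr_ge0// mulr_ge0// ltW.
suff Sx : total (Y u) <= x.
  apply/rV_norm_le => [|i]; first exact: ltW.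
  rewrite !mxE sub0r normrN ger0_norm; last exact: Y0 (ltW u0) i.
  by apply: le_trans Sx; apply: coord_total; apply: Y0; exact: ltW.
rewrite leNgt; apply/negP => xS.
have cD : cts_pos (fun v : R => x ^+ 2 / m%:R * v).
  by apply: cts_posM; [exact: cts_pos_cst|apply: continuous_subspaceT => ?; exact: cvg_id].
have dD (v : R) : 0 < v -> is_derive v 1 (fun v : R => x ^+ 2 / m%:R * v) (x ^+ 2 / m%:R).
  by move=> _; rewrite -[X in is_derive _ _ _ X]mulr1; exact: is_deriveZ.
have := ndecr_pos (cts_posB (cts_pos_comp (@oppr_continuous _ _) cS) cD)
  (fun v v0 => is_deriveB (is_deriveN (total_derive fY v0)) (dD v v0)) (lexx 0) (ltW u0).
rewrite /= mulr0 subr0 => H.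
have {}H : - total (Y 0) <= - total (Y u) - x ^+ 2 / m%:R * u.
  apply: H => v v0 vu; rewrite subr_ge0.
  have := dS v v0 => dSv.
  suff : x ^+ 2 / m%:R <= sqnorm (Y v) by lra.
  have xv : x <= total (Y v) by apply: le_trans (ltW xS) (noninc _ _ (ltW v0) (ltW vu)).
  have : 0 <= \sum_i (Y v 0 i - x / m%:R) ^+ 2 by apply: sumr_ge0 => i _; exact: sqr_ge0.
  have -> : \sum_i (Y v 0 i - x / m%:R) ^+ 2 =
      sqnorm (Y v) - 2 * (x / m%:R) * total (Y v) + x ^+ 2 / m%:R.
    have E y : (y - x / m%:R) ^+ 2 = y ^+ 2 - 2 * (x / m%:R) * y + (x / m%:R) ^+ 2 by ring.
    under eq_bigr do rewrite E.
    rewrite big_split sumrB/= -mulr_sumr sumr_const card_ord -mulr_natl.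
    by rewrite -/(sqnorm (Y v)) -/(total (Y v)); congr (_ + _); field; rewrite gt_eqF.
  have : x / m%:R * x <= x / m%:R * total (Y v).
    by rewrite ler_wpM2l// divr_ge0// ltW.
  have -> : x ^+ 2 / m%:R = x / m%:R * x by rewrite [RHS]mulrAC -expr2.
  lra.
have Su0 : 0 <= total (Y u) by apply: sumr_ge0 => i _; apply: Y0; exact: ltW.
have : r < x ^+ 2 / m%:R * u.
  move: ru; rewrite ltr_pdivrMr ?exprn_gt0// => ru.
  by rewrite mulrAC ltr_pdivlMr// [ltRHS]mulrC.
move: Yr H; lra.
Qed.

End Decay.

Hypothesis Cmr : C * (m%:R * r) <= 1.
Variable rho1 : R.
Hypothesis near1 : forall x y : 'rV[R]_m, `|x - 0| <= rho1 -> `|y - 0| <= rho1 ->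
  forall i j, `|secant c P Q x y i j - secant c P Q 0 0 i j| <= 1.
Hypothesis r_rho : r <= rho1.

Lemma small_exists (y : 'rV[R]_m) : nonneg y -> total y <= r ->
  exists Y, [/\ flow_of (vf c P Q) Y, forall u : R, 0 <= u -> nonneg (Y u) & Y 0 = y].
Proof.
move=> y0 yr.
pose G := cutoff c P Q 0 r [set: 'I_m]%SET.
have near_r (x z : 'rV[R]_m) : `|x - 0| <= r -> `|z - 0| <= r ->
    forall i j, `|secant c P Q x z i j - secant c P Q 0 0 i j| <= 1.
  by move=> xr zr; apply: near1; exact: le_trans r_rho.
have [K K0 LG] := cutoff_lip r0 [set: 'I_m]%SET ler01 near_r.
have [Y fY Y0] := flow_exists K0 LG y.
have GE (x : 'rV[R]_m) i : G x 0 i = vf c P Q (clip 0 r x) 0 i.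
  have s0 j : secant c P Q 0 0 i j = 0.
    by rewrite /secant /quad /dot big1 ?mxE => [|k _]; rewrite ?mxE; ring.
  rewrite /G cutoffE inE; rewrite !big1 ?add0r ?subr0// => j _; rewrite s0 mul0r//.
have Gi (x : 'rV[R]_m) i : `|G x 0 i| <= K * `|x 0 i|.
  pose x' : 'rV[R]_m := \row_j (if j == i then 0 else x 0 j).
  have Gx' : G x' 0 i = 0.
    rewrite GE !mxE eqxx !add0r; rewrite (min_idPr (ltW r0)) (max_idPr _) ?mul0r//.
    by rewrite oppr_le0 ltW.
  have xx' : `|x - x'| <= `|x 0 i|.
    apply/rV_norm_le => // j; rewrite !mxE; case: eqP => [->|_]; first by rewrite subr0.
    by rewrite subrr normr0.
  have := LG x x'; move/(rV_norm_le _ (mulr_ge0 (ltW K0) (normr_ge0 _)))/(_ i).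
  rewrite mxE [X in _ + X]mxE Gx' subr0 => /le_trans; apply.
  by rewrite ler_wpM2l// ltW.
have nn (u : R) : 0 <= u -> nonneg (Y u).
  move=> u0 i; case: (fY) => /cts_row cY dY.
  apply: (sign_preserved (cY i) (fun v v0 => dY v v0 i) _ _ u0) => [v v0|]; last by rewrite Y0.
  exact: Gi.
have clip_nn (z : 'rV[R]_m) : nonneg z ->
    nonneg (clip 0 r z) /\ total (clip 0 r z) <= m%:R * r.
  move=> z0; split=> [i|].
    by rewrite !mxE le_max le_min !add0r (ltW r0) z0 orbT.
  apply: sum_ord_le => i; rewrite !mxE ge_max ge_min !add0r lexx/= andbT.
  by apply: (@le_trans _ _ 0); rewrite ?oppr_le0 ltW.
have Yr (u : R) : 0 <= u -> total (Y u) <= r.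
  move=> u0; apply: le_trans yr; rewrite -Y0 -lerN2.
  apply: (ndecr_pos (cts_pos_comp (@oppr_continuous _ _) (total_cts fY.1))
    (fun v v0 => is_deriveN (total_derive fY v0)) (lexx 0) u0) => v v0 _.
  have [cn ct] := clip_nn _ (nn v (ltW v0)).
  have -> : total (cutoff c P Q 0 r [set: 'I_m]%SET (Y v)) = total (vf c P Q (clip 0 r (Y v))).
    by apply: eq_bigr => i _; exact: GE.
  rewrite oppr_ge0; apply: le_trans (total_vf_le cn) _.
  rewrite mulr_le0_ge0// subr_le0.
  have : C * total (clip 0 r (Y v)) <= C * (m%:R * r) by rewrite ler_wpM2l.
  move: Cmr; lra.
exists Y; split=> //; split; first exact: fY.1.
move=> u u0 i; have := fY.2 u u0 i; rewrite -/G GE clip_id//.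
apply/rV_norm_le => [|j]; first exact: ltW.
rewrite !mxE subr0 ger0_norm; last exact: nn (ltW u0) j.
by apply: le_trans (Yr u (ltW u0)); apply: coord_total; apply: nn; exact: ltW.
Qed.

End Small.

(** * Reduction to the weighted system *)

Section Reduction.
Variables (R : realType) (m : nat) (n p : 'I_m -> nat) (q : 'I_m -> int).
Hypothesis hn : forall i, (0 < n i)%N.
Hypothesis hp : forall i, (0 < p i)%N.
Hypothesis hq : forall i, q i != 0.

Definition wt (i : 'I_m) : R := (n i)%:R * (q i)%:~R ^+ 2.
Definition ric (i : 'I_m) : R := (p i)%:R.
Definition sqq (i : 'I_m) : R := (q i)%:~R ^+ 2.

Lemma quad_wt (y : 'rV[R]_m) : quad wt y = E n q y.
Proof. by apply: eq_bigr => i _; rewrite /wt -mulrA -expr2. Qed.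

Lemma vf_F (y : 'rV[R]_m) i : vf wt ric sqq y 0 i = - y 0 i * F n p q i y.
Proof. by rewrite mxE quad_wt /F /sqq /ric; ring. Qed.

Lemma solution_flow (Y : R -> 'rV[R]_m) :
  solution_Y n p q Y <->
  (forall u : R, 0 <= u -> forall i, 0 <= Y u 0 i) /\ flow_of (vf wt ric sqq) Y.
Proof.
split=> [[Y0 cY dY]|[Y0 [cY dY]]]; split=> //.
  by split=> // u u0 i; rewrite vf_F; exact: dY.
by move=> u u0 i; rewrite -vf_F; exact: dY.
Qed.

Lemma sqq_ge1 i : 1 <= sqq i.
Proof.
have : 0 < q i ^+ 2 by rewrite exprn_even_gt0//= hq.
by rewrite /sqq -rmorphXn/= -[1]/(1%:~R) ler_int -gtz0_ge1.
Qed.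

Lemma sqq_ge0 i : 0 <= sqq i.
Proof. exact: sqr_ge0. Qed.

Lemma sqq_le_wt i : sqq i <= wt i.
Proof. by rewrite /wt ler_peMl ?sqr_ge0// ler1n. Qed.

Lemma wt_ge1 i : 1 <= wt i.
Proof. exact: le_trans (sqq_ge1 i) (sqq_le_wt i). Qed.

Lemma ric_ge1 i : 1 <= ric i.
Proof. by rewrite ler1n. Qed.

Lemma family_to_equilibrium (th : {set 'I_m}) (v : 'rV[R]_m) (d : nat) :
  d = (#|th| - 2)%N -> is_v n p q th v -> (2 <= #|th|)%N ->
  exists Phi : 'rV[R]_d -> R -> 'rV[R]_m,
    C0_family n p q setT Phi /\
    forall s, [/\ Phi s u @[u --> +oo] --> v, supported th v,
      forall u : R, 0 <= u -> forall i, i \in th -> 0 < Phi s u 0 i &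
      forall u : R, 0 <= u -> supported th (Phi s u)].
Proof.
move=> -> [vth vsupp] th2.
have v0 i : i \in th -> 0 < v 0 i by move=> /vth[].
have eqv i : i \in th -> quad wt v + sqq i * v 0 i ^+ 2 = 2 * ric i * v 0 i.
  by move=> /vth[_]; rewrite quad_wt /F /sqq /ric; lra.
have [Phi [cP fP sP pP lP]] :=
  convergent_family wt_ge1 sqq_ge0 sqq_le_wt v0 eqv vsupp th2.
exists Phi; split; last first.
  by move=> s; split=> // u u0; have [] := pP s u u0.
split=> //.
- exact: openT.
- by exists 0.
- move=> s _; have [fs ns] := fP s; split=> //; apply/solution_flow; split=> // u u0 i.
  have [su pu] := pP s u u0.
  by have [ith|ith] := boolP (i \in th); [rewrite ltW// pu|rewrite su].
- by move=> s s' _ _; exact: sP.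
Qed.

End Reduction.

Theorem theorem3p6 (R : realType) (m : nat) (n p : 'I_m -> nat)
    (q : 'I_m -> int)
    (hm : (0 < m)%N) (hn : forall i, (0 < n i)%N) (hp : forall i, (0 < p i)%N)
    (hq : forall i, q i != 0) :
  [/\ exists2 c0 : R, 0 < c0 &
        (forall y : 'rV[R]_m, (forall i, 0 <= y 0 i) ->
           \sum_(i < m) y 0 i <= c0 ->
           exists2 Y : R -> 'rV[R]_m, solution_Y n p q Y & Y 0 = y) /\
        (forall Y : R -> 'rV[R]_m, solution_Y n p q Y ->
           \sum_(i < m) Y 0 0 i <= c0 ->
           Y u @[u --> +oo] --> (0 : 'rV[R]_m) /\
           (positive_Y Y -> yields_ancient_solution n p q Y)),
      forall xi : 'rV[R]_m, is_xi n p q xi -> (2 <= m)%N ->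
        exists (U : set 'rV[R]_(m - 2)) (Phi : 'rV[R]_(m - 2) -> R -> 'rV[R]_m),
          C0_family n p q U Phi /\
          forall s, U s ->
            [/\ Phi s u @[u --> +oo] --> xi,
                positive_Y (Phi s) &
                yields_ancient_solution n p q (Phi s)] &
      forall (theta : {set 'I_m}) (v : 'rV[R]_m),
        theta != finset.set0 -> theta != finset.setTfor 'I_m ->
        is_v n p q theta v ->
        (2 <= #|theta|)%N ->
        exists (U : set 'rV[R]_(#|theta| - 2))
               (Phi : 'rV[R]_(#|theta| - 2) -> R -> 'rV[R]_m),
          C0_family n p q U Phi /\
          forall s, U s ->
            [/\ Phi s u @[u --> +oo] --> v,
                forall k, k \notin theta -> forall u : R, 0 <= u -> Phi s u 0 k = 0 &
                ~ exists (a0 : R) a b, 0 < a0 /\ corresponds n q (Phi s) a0 a b]].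
Proof.
split.
- pose c := @wt R m n q; pose Q := @sqq R m q; pose P := @ric R m p.
  have c0 i : 0 <= c i by exact: le_trans ler01 (wt_ge1 R hn hq i).
  have Q0 i : 0 <= Q i by exact: sqq_ge0.
  have P1 i : 1 <= P i by exact: ric_ge1.
  have [rho1 rho10 near1] := secant_near c P Q 0 (ltr01 : 0 < (1 : R)).
  pose C := \sum_i c i + \sum_i Q i.
  have C0 : 0 <= C by rewrite addr_ge0 ?sumr_ge0.
  have Cm0 : 0 <= C * m%:R by rewrite mulr_ge0.
  pose r := Num.min rho1 (C * m%:R + 1)^-1.
  have r0 : 0 < r by rewrite lt_min rho10 invr_gt0 ltr_wpDl.
  have Cmr : C * (m%:R * r) <= 1.
    rewrite mulrA; apply: (@le_trans _ _ (C * m%:R * (C * m%:R + 1)^-1)).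
      by rewrite ler_wpM2l// ge_min lexx orbT.
    by rewrite ler_pdivrMr ?ltr_wpDl// mul1r lerDl.
  have Cr : C * r <= 1.
    apply: le_trans Cmr; rewrite ler_wpM2l// ler_peMl ?ler1n//; exact: ltW.
  have r_rho : r <= rho1 by rewrite ge_min lexx.
  exists r => //; split.
    move=> y y0 yr.
    have [Y [fY Y0 Yy]] := small_exists c0 Q0 P1 r0 Cmr near1 r_rho y0 yr.
    by exists Y => //; apply/solution_flow.
  move=> Y sY Yr; have [Y0 fY] := (solution_flow _ _ _ _).1 sY.
  have lim := small_tends_to0 hm c0 Q0 P1 r0 Cr fY Y0 Yr.
  split; first exact: lim.
  exact: positive_yields_ancient.
- move=> xi xiP m2.
  have th2 : (2 <= #|[set: 'I_m]%SET|)%N by rewrite cardsT card_ord.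
  have dE : (m - 2 = #|[set: 'I_m]%SET| - 2)%N by rewrite cardsT card_ord.
  have vP : is_v n p q [set: 'I_m]%SET xi by split=> [i _|j]; rewrite ?inE//.
  have [Phi [CP PP]] := family_to_equilibrium hn hq dE vP th2.
  exists setT, Phi; split=> // s _; have [lP _ pP _] := PP s.
  have pos : positive_Y (Phi s) by move=> u u0 i; apply: pP; rewrite ?inE.
  split=> //; apply: positive_yields_ancient => //.
  by case: CP => _ _ _ /(_ s I)[].
- move=> theta v _ thT vP th2.
  have [Phi [CP PP]] := family_to_equilibrium hn hq (erefl _) vP th2.
  exists setT, Phi; split=> // s _; have [lP _ _ sP] := PP s.
  split=> //.
    by move=> k kth u u0; exact: sP.
  move=> [a0 [a [b [a00 cab]]]].
  have [k kth] : exists k, k \notin theta.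
    apply/existsP; rewrite -negb_forall; apply: contra thT => /forallP H.
    by apply/eqP/setP => i; rewrite H inE.
  have [[a1 b1] _ /(_ k)] := cab 0 (lexx 0).
  rewrite sP// => /eqP; rewrite eq_sym gt_eqF// divr_gt0//.
Qed.
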